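(* Let $a,b\in\mathbb{R}$ with $b>0$, $a^2+b^2>1$ and $0\leq a\leq 1/2$. Let $\Gamma_{a,b}=\mathbb{Z}(1,0)+\mathbb{Z}(a,b)\subset\mathbb{R}^2$ and let $g_{a,b}$ be the flat metric on the torus $\mathbb{T}^2\cong\mathbb{R}^2/\Gamma_{a,b}$ induced by the Euclidean metric on $\mathbb{R}^2$. Then $g_{a,b}$ is not $\bar\lambda_1$-conformally maximal, i.e. there exists a smooth metric $h$ in the conformal class $[g_{a,b}]$ with $$\lambda_1(\mathbb{T}^2,h)\,\mathrm{Area}(\mathbb{T}^2,h)>\lambda_1(\mathbb{T}^2,g_{a,b})\,\mathrm{Area}(\mathbb{T}^2,g_{a,b}).$$
   Context: For a closed connected Riemannian surface $(M,g)$, let $0=\lambda_0(M,g)<\lambda_1(M,g)\leq\lambda_2(M,g)\leq\cdots$ denote the eigenvalues, repeated with multiplicity, of the (non-negative) Laplace-Beltrami operator $\Delta_g$. The conformal class of $g$ is $[g]=\{e^{2\omega}g : \omega\in C^\infty(M)\}$. Set $\bar\lambda_k(M,h)=\lambda_k(M,h)\,\mathrm{Area}(M,h)$ and $\Lambda_k(M,[g])=\sup_{h\in[g]}\bar\lambda_k(M,h)$. A metric $g$ is called $\bar\lambda_k$-conformally maximal if $\bar\lambda_k(M,g)=\Lambda_k(M,[g])$. *)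

(* Defs.v *)
From Stdlib Require Import Reals ZArith Lra FunctionalExtensionality ClassicalEpsilon.
From Coquelicot Require Import Coquelicot.

Set Implicit Arguments.
Unset Strict Implicit.
Unset Printing Implicit Defensive.

Open Scope R_scope.

Definition dx (f : R -> R -> R) (x y : R) : R := Derive (fun t => f t y) x.
Definition dy (f : R -> R -> R) (x y : R) : R := Derive (fun t => f x t) y.

Fixpoint Ck (n : nat) (f : R -> R -> R) : Prop :=
  match n with
  | O => forall x y, continuity_2d_pt f x y
  | S m =>
      (forall x y, ex_derive (fun t => f t y) x /\ ex_derive (fun t => f x t) y)
      /\ Ck m (dx f) /\ Ck m (dy f)
  end.

Definition smooth (f : R -> R -> R) : Prop := forall n, Ck n f.

(* The lattice Z(1,0) + Z(a,b). *)
Definition Gamma (a b u v : R) : Prop :=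
  exists m n : Z, u = IZR m * 1 + IZR n * a /\ v = IZR m * 0 + IZR n * b.

(* Smooth functions on the torus R^2 / Gamma_{a,b} are represented by their
   lifts to R^2, i.e. by the smooth Gamma_{a,b}-periodic functions. *)
Definition Cinf (a b : R) (f : R -> R -> R) : Prop :=
  smooth f /\ forall u v, Gamma a b u v -> forall x y, f (x + u) (y + v) = f x y.

(* The smooth Riemannian metric gE dx^2 + 2 gF dx dy + gG dy^2 on
   R^2 / Gamma_{a,b}. *)
Record metric (a b : R) : Type := Metric {
  gE : R -> R -> R;
  gF : R -> R -> R;
  gG : R -> R -> R;
  gE_Cinf : Cinf a b gE;
  gF_Cinf : Cinf a b gF;
  gG_Cinf : Cinf a b gG;
  metric_pos : forall x y, 0 < gE x y /\ 0 < gE x y * gG x y - gF x y ^ 2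
}.

Lemma Ck_const (n : nat) (c : R) : Ck n (fun _ _ => c).
Proof.
revert c; induction n as [|n IH]; intros c; simpl.
- intros x y; apply continuity_2d_pt_const.
- split; [intros x y; split; apply ex_derive_const|].
  assert (H : dx (fun _ _ => c) = (fun _ _ => 0) /\
              dy (fun _ _ => c) = (fun _ _ => 0)).
  { split; apply functional_extensionality; intros x;
      apply functional_extensionality; intros y; apply (Derive_const c). }
  destruct H as [-> ->]; split; apply IH.
Qed.

Lemma Cinf_const (a b c : R) : Cinf a b (fun _ _ => c).
Proof. split; [intros n; apply Ck_const | reflexivity]. Qed.

Lemma flat_pos (x y : R) : 0 < 1 /\ 0 < 1 * 1 - 0 ^ 2.
Proof. lra. Qed.

(* The metric g_{a,b} induced by the Euclidean metric dx^2 + dy^2. *)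
Definition flat_metric (a b : R) : metric a b :=
  Metric (Cinf_const a b 1) (Cinf_const a b 0) (Cinf_const a b 1) flat_pos.

Definition conformal (a b : R) (g h : metric a b) : Prop :=
  exists omega : R -> R -> R, Cinf a b omega /\
    forall x y,
      gE h x y = exp (2 * omega x y) * gE g x y /\
      gF h x y = exp (2 * omega x y) * gF g x y /\
      gG h x y = exp (2 * omega x y) * gG g x y.

Definition dens (a b : R) (g : metric a b) (x y : R) : R :=
  sqrt (gE g x y * gG g x y - gF g x y ^ 2).

(* The integral of the area density over the fundamental parallelogram
   { s (1,0) + t (a,b) : 0 <= s, t <= 1 }, written in the coordinates (s,t);
   the Jacobian is |det ((1,0),(a,b))| = |b|. *)
Definition area (a b : R) (g : metric a b) : R :=
  RInt (fun t => RInt (fun s => dens g (s + t * a) (t * b) * Rabs b) 0 1) 0 1.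

(* - 1/sqrt(det g) * sum_{i,j} d_i (sqrt(det g) g^{ij} d_j u), where
   (g^{ij}) = 1/(det g) * ((gG, - gF), (- gF, gE)). *)
Definition laplace (a b : R) (g : metric a b) (u : R -> R -> R) (x y : R) : R :=
  - (/ dens g x y *
     (dx (fun x y => (gG g x y * dx u x y - gF g x y * dy u x y) / dens g x y) x y
      + dy (fun x y => (gE g x y * dy u x y - gF g x y * dx u x y) / dens g x y) x y)).

Definition eigenspace (a b : R) (g : metric a b)
    (mu : R) (u : R -> R -> R) : Prop :=
  Cinf a b u /\ forall x y, laplace g u x y = mu * u x y.

Definition lin_indep (k : nat) (u : nat -> R -> R -> R) : Prop :=
  forall c : nat -> R,
    (forall x y, sum_f_R0 (fun i => c i * u i x y) k = 0) ->
    forall i, (i <= k)%nat -> c i = 0.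

(* More than k eigenvalues, counted with multiplicity, satisfy P. *)
Definition more_eigenvalues (a b : R) (g : metric a b)
    (P : R -> Prop) (k : nat) : Prop :=
  exists u : nat -> R -> R -> R,
    lin_indep k u /\
    forall i, (i <= k)%nat -> exists mu, P mu /\ eigenspace g mu (u i).

(* l is the entry with index k (counting from 0) of the nondecreasing list of
   the eigenvalues repeated with multiplicity: at most k of them are < l and
   more than k of them are <= l. *)
Definition is_lambda (a b : R) (k : nat) (g : metric a b) (l : R) : Prop :=
  ~ more_eigenvalues g (fun mu => mu < l) k /\
  more_eigenvalues g (fun mu => mu <= l) k.

Definition lambda (a b : R) (k : nat) (g : metric a b) : R :=
  epsilon (inhabits 0) (is_lambda k g).

Definition lambda_bar (a b : R) (k : nat) (g : metric a b) : R :=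
  lambda k g * area g.

Definition Lambda (a b : R) (k : nat) (g : metric a b) : Rbar :=
  Lub_Rbar (fun v => exists h : metric a b, conformal g h /\ v = lambda_bar k h).

Definition conformally_maximal (a b : R) (k : nat) (g : metric a b) : Prop :=
  Finite (lambda_bar k g) = Lambda k g.

(* Main.v *)
Require Import Defs.
From Stdlib Require Import Reals Lra Lia FunctionalExtensionality ClassicalEpsilon.
From Coquelicot Require Import Coquelicot.
Open Scope R_scope.

(** The proof exhibits a better metric explicitly.

    The dual lattice of [Gamma a b] has shortest vector (0, 1/b), so that
    lambda_1 of the flat torus is 4 PI^2 / b^2, with eigenfunctions the cosine
    and the sine of 2 PI y / b; because a^2 + b^2 > 1, every mode that depends
    on x lies strictly above.  The flat metric is a critical point of the
    normalised eigenvalue in its conformal class, so a gain has to be of second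
    order; it comes from conformal factors that depend on y alone and have the
    same frequency as the first eigenfunctions.

    For a function of t = y / b the eigenvalue equation of the conformal metric
    w (dx^2 + dy^2) at the level 4 PI^2 / b^2 is Hill's equation
    f'' = - 4 PI^2 w f.  It has two independent periodic solutions
    cos(phi) / sqrt(phi') and sin(phi) / sqrt(phi') as soon as phi is a lift of
    a circle diffeomorphism, phi (t + 1) = phi t + 2 PI, and 4 PI^2 w is
    phi'^2 plus half of the Schwarzian derivative of phi.  The choice
    phi t = 2 PI t + e sin (2 PI t) ([phase]) gives the weight [weight e], which
    is 1 for e = 0.  For small e > 0 two things hold.

    - lambda_1 of the weighted metric is still 4 PI^2 / b^2
      ([has_weight_lambda]).
    - The integral of [weight e] over a period exceeds 1 ([int_weight_gt_1]):
      integrating the Schwarzian by parts leaves the integral of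
      phi'^2 - (phi'' / phi')^2 / 4, up to the factor 4 PI^2, and the mode of
      frequency one in phi' adds more to the first term than it takes away
      through the second.  So the area grows ([has_weight_area]).

    The substance of the first point is that an eigenfunction below
    4 PI^2 / b^2 is constant.  By Green's formula ([energy]) this follows from
    the Poincare inequality [weighted_poincare] with the constant
    4 PI^2 / b^2.  A function on the torus is split into its mean over the
    horizontal circles, which depends on t alone, and a remainder.

    - For the mean, the inequality is [wirtinger]: subtracting a constant, a
      periodic function vanishes at two points whose phases differ by PI, and
      on each of the two arcs between them the Dirichlet problem for Hill's
      equation has a positive solution.
    - For the remainder, the Euclidean norm squared of the gradient is a
      nonnegative combination of the squares of the derivatives along the
      closed geodesics (1,0), (a,b) and (a-1,b) of the lattice.  The Wirtinger
      inequality on these geodesics and a Bessel inequality for the means over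
      the last two families give the constant
      4 PI^2 (a^2 + b^2) / b^2 ([poincare_mean_zero]).  As a^2 + b^2 > 1, this
      leaves room for a weight that is slightly larger than 1.

    Both metrics, flat and weighted, are treated at once: the flat one is the
    case e = 0. *)

(** * Continuous functions and their integrals *)

Definition cont {U : UniformSpace} (f : U -> R) : Prop := forall x, continuous f x.

(** Continuity in the sense of the product uniform space, which composes more
    easily than [continuity_2d_pt]. *)
Definition cont2 (f : R -> R -> R) : Prop :=
  cont (fun p : R * R => f (fst p) (snd p)).

Lemma cont_ext {U : UniformSpace} (f g : U -> R) :
  (forall x, f x = g x) -> cont f -> cont g.
Proof. intros E H x; apply (continuous_ext f g); auto. Qed.

Lemma cont_const {U : UniformSpace} (c : R) : cont (fun _ : U => c).
Proof. intros x; apply continuous_const. Qed.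

Lemma cont_id : cont (fun x : R => x).
Proof. intros x; apply continuous_id. Qed.

Lemma cont_plus {U : UniformSpace} (f g : U -> R) :
  cont f -> cont g -> cont (fun x => f x + g x).
Proof. intros Hf Hg x; apply (continuous_plus (V := R_NormedModule) f g); auto. Qed.

Lemma cont_opp {U : UniformSpace} (f : U -> R) : cont f -> cont (fun x => - f x).
Proof. intros Hf x; apply (continuous_opp (V := R_NormedModule) f); auto. Qed.

Lemma cont_minus {U : UniformSpace} (f g : U -> R) :
  cont f -> cont g -> cont (fun x => f x - g x).
Proof. intros Hf Hg; apply (cont_plus f (fun x => - g x)); [|apply cont_opp]; auto. Qed.

Lemma cont_mult {U : UniformSpace} (f g : U -> R) :
  cont f -> cont g -> cont (fun x => f x * g x).
Proof. intros Hf Hg x; apply (continuous_mult (K := R_AbsRing) f g); auto. Qed.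

Lemma cont_sqr {U : UniformSpace} (f : U -> R) : cont f -> cont (fun x => f x ^ 2).
Proof.
intros Hf; apply (cont_ext (fun x => f x * f x)); [intros; ring|].
now apply cont_mult.
Qed.

Lemma cont_comp {U : UniformSpace} (g : R -> R) (f : U -> R) :
  cont g -> cont f -> cont (fun x => g (f x)).
Proof. intros Hg Hf x; apply (continuous_comp f g); auto. Qed.

Lemma cont_comp2 {U : UniformSpace} (h : R -> R -> R) (f g : U -> R) :
  cont2 h -> cont f -> cont g -> cont (fun x => h (f x) (g x)).
Proof.
intros Hh Hf Hg x; apply (continuous_comp_2 f g h);
  [apply Hf|apply Hg|exact (Hh (f x, g x))].
Qed.

Lemma cont_fst : cont (fun p : R * R => fst p).
Proof. intros [x y]; apply continuous_fst. Qed.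

Lemma cont_snd : cont (fun p : R * R => snd p).
Proof. intros [x y]; apply continuous_snd. Qed.

Lemma cont_derive (f f' : R -> R) : (forall x, is_derive f x (f' x)) -> cont f.
Proof. intros H x; apply (ex_derive_continuous (V := R_NormedModule) f); exists (f' x); apply H. Qed.

Lemma cont2_pt (f : R -> R -> R) :
  cont2 f <-> forall x y, continuity_2d_pt f x y.
Proof.
split.
- intros H x y; apply continuity_2d_pt_filterlim; exact (H (x, y)).
- intros H [x y]; apply (proj1 (continuity_2d_pt_filterlim f x y)); auto.
Qed.

(** [ring] recognises an equation only when its type is syntactically [R], and
    integrals bring in a convertible type. *)
Ltac real_eq := match goal with |- ?l = ?r => change (@eq R l r) end.

(** Goals are matched on their head symbol, because unification against the
    lemmas would unfold the real operations. *)
Ltac cont_tac :=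
  repeat first
  [ assumption
  | match goal with
    | |- cont2 _ => unfold cont2
    | |- cont (fun x => x) => apply cont_id
    | |- cont (fun p => fst p) => apply cont_fst
    | |- cont (fun p => snd p) => apply cont_snd
    | |- cont (fun x => @?f x + @?g x) => apply (cont_plus f g)
    | |- cont (fun x => @?f x - @?g x) => apply (cont_minus f g)
    | |- cont (fun x => @?f x * @?g x) => apply (cont_mult f g)
    | |- cont (fun x => - @?f x) => apply (cont_opp f)
    | |- cont (fun x => @?f x ^ 2) => apply (cont_sqr f)
    | |- cont (fun _ => ?c) => apply (cont_const c)
    | H : cont2 ?h |- cont (fun x => ?h (@?f x) (@?g x)) => apply (cont_comp2 h f g H)
    | H : cont2 ?h |- cont (?h ?c) => apply (cont_comp2 h (fun _ => c) (fun y => y) H)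
    | H : cont ?h |- cont (fun x => ?h (@?f x)) => apply (cont_comp h f H)
    end ].

Lemma cont_ex_RInt (f : R -> R) (a b : R) : cont f -> ex_RInt f a b.
Proof. intros H; apply (ex_RInt_continuous f); auto. Qed.

Lemma int_plus (f g : R -> R) (a b : R) : cont f -> cont g ->
  RInt (fun x => f x + g x) a b = RInt f a b + RInt g a b.
Proof. intros; apply (RInt_plus f g); now apply cont_ex_RInt. Qed.

Lemma int_minus (f g : R -> R) (a b : R) : cont f -> cont g ->
  RInt (fun x => f x - g x) a b = RInt f a b - RInt g a b.
Proof. intros; apply (RInt_minus f g); now apply cont_ex_RInt. Qed.

Lemma int_scal (f : R -> R) (c a b : R) : cont f ->
  RInt (fun x => c * f x) a b = c * RInt f a b.
Proof. intros; apply (RInt_scal f a b c); now apply cont_ex_RInt. Qed.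

Lemma int_const (c a b : R) : RInt (fun _ => c) a b = (b - a) * c.
Proof. apply (RInt_const a b c). Qed.

Lemma int_ext (f g : R -> R) (a b : R) :
  (forall x, f x = g x) -> RInt f a b = RInt g a b.
Proof. intros H; apply RInt_ext; auto. Qed.

Lemma int_le (f g : R -> R) (a b : R) : a <= b -> cont f -> cont g ->
  (forall x, f x <= g x) -> RInt f a b <= RInt g a b.
Proof. intros; apply RInt_le; auto; now apply cont_ex_RInt. Qed.

Lemma int_ge_0 (f : R -> R) (a b : R) : a <= b -> cont f ->
  (forall x, 0 <= f x) -> 0 <= RInt f a b.
Proof. intros; apply RInt_ge_0; auto; now apply cont_ex_RInt. Qed.

Lemma int_Chasles (f : R -> R) (a b c : R) : cont f ->
  RInt f a b + RInt f b c = RInt f a c.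
Proof. intros H; apply (RInt_Chasles f); now apply cont_ex_RInt. Qed.

Lemma int_derive (f f' : R -> R) (a b : R) :
  (forall x, is_derive f x (f' x)) -> cont f' -> RInt f' a b = f b - f a.
Proof.
intros H H'; apply is_RInt_unique.
apply (is_RInt_derive f f'); auto.
Qed.

Lemma int_lin (f : R -> R) (u v a b : R) : cont f ->
  RInt (fun x => u * f (u * x + v)) a b = RInt f (u * a + v) (u * b + v).
Proof. intros H; apply (RInt_comp_lin f u v a b); now apply cont_ex_RInt. Qed.

Lemma int_shift (f : R -> R) (a b c : R) : cont f ->
  RInt (fun x => f (x + c)) a b = RInt f (a + c) (b + c).
Proof.
intros H; rewrite <- (int_ext (fun x => 1 * f (1 * x + c))).
- rewrite int_lin by auto; f_equal; ring.
- intros x; rewrite !Rmult_1_l; reflexivity.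
Qed.

Definition periodic (f : R -> R) : Prop := forall x, f (x + 1) = f x.

Lemma int_period (f : R -> R) (c : R) : cont f -> periodic f ->
  RInt f c (c + 1) = RInt f 0 1.
Proof.
intros H P.
assert (E : RInt f c 0 = RInt f (c + 1) (0 + 1)).
{ rewrite <- int_shift by auto; apply int_ext; intros; now rewrite P. }
generalize (int_Chasles f c 0 1 H) (int_Chasles f c (c + 1) 1 H).
rewrite E, Rplus_0_l; lra.
Qed.

Lemma int_period_shift (f : R -> R) (c : R) : cont f -> periodic f ->
  RInt (fun x => f (x + c)) 0 1 = RInt f 0 1.
Proof.
intros H P; rewrite int_shift by auto.
rewrite Rplus_0_l, (Rplus_comm 1 c); now apply int_period.
Qed.

(** A positive value at x stays positive on some [x, x + r] with r <= 1, and
    the integral over the period starting at x is at least that over this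
    piece, hence positive. *)
Lemma periodic_zero (f : R -> R) : cont f -> periodic f ->
  (forall x, 0 <= f x) -> RInt f 0 1 = 0 -> forall x, f x = 0.
Proof.
intros H P Hp H0 x.
destruct (Hp x) as [Hx|]; [exfalso|auto].
assert (L : locally x (fun y => 0 < f y)).
{ apply (H x); exists (mkposreal _ Hx); intros z Hz.
  unfold ball in Hz; simpl in Hz; unfold AbsRing_ball, abs, minus, plus, opp in Hz; simpl in Hz.
  apply Rabs_def2 in Hz; lra. }
destruct L as [d Hd].
set (r := Rmin (d / 2) (1 / 2)).
assert (Hr : 0 < r) by (apply Rmin_glb_lt; generalize (cond_pos d); lra).
assert (r <= d / 2) by apply Rmin_l.
assert (r <= 1 / 2) by apply Rmin_r.
assert (A : 0 < RInt f x (x + r)).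
{ apply RInt_gt_0; [lra| |intros; apply H].
  intros y Hy; apply Hd.
  unfold ball; simpl; unfold AbsRing_ball, abs, minus, plus, opp; simpl.
  apply Rabs_def1; generalize (cond_pos d); lra. }
assert (B : 0 <= RInt f (x + r) (x + 1)) by (apply int_ge_0; auto; lra).
generalize (int_Chasles f x (x + r) (x + 1) H).
rewrite int_period by auto; lra.
Qed.

(** * Integrals depending on a parameter *)

Lemma cont_int_param (f : R -> R -> R) (a b : R) : a <= b -> cont2 f ->
  cont (fun t : R => RInt (fun s => f s t) a b).
Proof.
intros Hab H t0; apply continuity_pt_filterlim; intros eps Heps.
assert (Hd : 0 < eps / (b - a + 1)) by (apply Rdiv_lt_0_compat; lra).
destruct (uniform_continuity_2d_1d f a b t0
  (fun x _ => proj1 (cont2_pt f) H x t0) (mkposreal _ Hd)) as [d D].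
exists d; split; [apply cond_pos|].
intros t [_ Ht]; simpl in *; unfold R_dist in *.
assert (C : forall t, cont (fun s : R => f s t)) by (intros; cont_tac).
rewrite <- (int_minus (fun s => f s t) (fun s => f s t0)) by auto.
apply Rle_lt_trans with ((b - a) * (eps / (b - a + 1))).
2:{ apply Rlt_le_trans with ((b - a + 1) * (eps / (b - a + 1))); [nra|].
    right; field; lra. }
apply abs_RInt_le_const; auto.
{ apply cont_ex_RInt; apply cont_minus; auto. }
intros s Hs; apply Rlt_le, (D s t0 s t); auto.
- generalize (cond_pos d); lra.
- apply Rabs_def2 in Ht; lra.
- rewrite Rminus_diag, Rabs_R0; apply cond_pos.
Qed.

Lemma derive_int_param (f f' : R -> R -> R) (a b : R) :
  (forall s t, is_derive (fun z => f s z) t (f' s t)) ->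
  (forall t, cont (fun s : R => f s t)) -> cont2 f' ->
  forall t, is_derive (fun z => RInt (fun s => f s z) a b) t (RInt (fun s => f' s t) a b).
Proof.
intros H C C' t.
replace (RInt (fun s => f' s t) a b)
  with (RInt (fun s => Derive (fun z => f s z) t) a b)
  by (apply int_ext; intros; apply is_derive_unique, H).
apply (is_derive_RInt_param (fun z s => f s z)).
- exists (mkposreal 1 Rlt_0_1); intros; eexists; apply H.
- intros s _; apply (continuity_2d_pt_ext (fun u v => f' v u)).
  + intros; symmetry; apply is_derive_unique, H.
  + apply (proj1 (cont2_pt (fun u v => f' v u))); cont_tac.
- exists (mkposreal 1 Rlt_0_1); intros; apply cont_ex_RInt, C.
Qed.

Lemma derive_int_ub (f : R -> R) (a : R) : cont f ->
  forall x, is_derive (fun z => RInt f a z) x (f x).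
Proof.
intros H x; apply (is_derive_RInt f (fun z => RInt f a z) a x); [|apply H].
exists (mkposreal 1 Rlt_0_1); intros; apply (RInt_correct f); now apply cont_ex_RInt.
Qed.

Lemma eq_derive_eq (f g h : R -> R) (a b : R) :
  (forall x, is_derive f x (h x)) -> (forall x, is_derive g x (h x)) ->
  cont h -> f a = g a -> f b = g b.
Proof.
intros Hf Hg Hh E.
generalize (int_derive f h a b Hf Hh) (int_derive g h a b Hg Hh); lra.
Qed.

Lemma zero_derive_const (f : R -> R) : (forall x, is_derive f x 0) ->
  forall x y, f x = f y.
Proof.
intros H x y.
assert (E := int_derive f (fun _ => 0) x y H (cont_const 0)).
rewrite int_const in E; lra.
Qed.

(** Both iterated integrals over [0,1] x [0,z], as functions of z, vanish at 0
    and have the integral of f s z over s as derivative. *)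
Lemma fubini (f : R -> R -> R) : cont2 f ->
  RInt (fun t => RInt (fun s => f s t) 0 1) 0 1 =
  RInt (fun s => RInt (fun t => f s t) 0 1) 0 1.
Proof.
intros H.
assert (C : forall z, cont (fun s : R => RInt (fun t => f s t) 0 z)).
{ intros z.
  apply (cont_ext (fun s => RInt (fun t => z * f s (t * z)) 0 1)).
  - intros s.
    rewrite <- (int_ext (fun t => z * f s (z * t + 0))).
    + rewrite (int_lin (fun t => f s t)) by cont_tac; f_equal; ring.
    + intros t; do 2 f_equal; ring.
  - apply (cont_int_param (fun t s => z * f s (t * z))); [lra|cont_tac]. }
apply (eq_derive_eq
  (fun z => RInt (fun t => RInt (fun s => f s t) 0 1) 0 z)
  (fun z => RInt (fun s => RInt (fun t => f s t) 0 z) 0 1)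
  (fun z => RInt (fun s => f s z) 0 1) 0 1).
- apply derive_int_ub, cont_int_param; [lra|auto].
- apply (derive_int_param (fun s z => RInt (fun t => f s t) 0 z)); auto.
  intros s t; apply (derive_int_ub (fun t => f s t)); cont_tac.
- apply cont_int_param; [lra|auto].
- rewrite (RInt_point 0); symmetry.
  rewrite (int_ext _ (fun _ => 0)).
  + rewrite int_const; unfold zero; simpl; ring.
  + intros x; exact (RInt_point 0 (fun t => f x t)).
Qed.

(** * A circle diffeomorphism and the weight of its Hill equation *)

(** The square of F' - H F integrates to the difference of the two sides,
    because 2 H F F' + H' F^2 is the derivative of H F^2, which vanishes at
    both ends.  With H = w' / w the coefficient - (H' + H^2) is - w'' / w:
    this is the first-eigenvalue bound for a Dirichlet problem that has a
    positive solution w on the closed interval. *)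
Lemma riccati_dirichlet (F F' H H' : R -> R) (p r : R) : p <= r ->
  (forall x, is_derive F x (F' x)) -> cont F' ->
  (forall x, p <= x <= r -> is_derive H x (H' x)) ->
  (forall x, p <= x <= r -> continuous H' x) ->
  F p = 0 -> F r = 0 ->
  RInt (fun x => - (H' x + H x ^ 2) * F x ^ 2) p r <= RInt (fun x => F' x ^ 2) p r.
Proof.
intros pr dF CF' dH CH' Fp Fr.
assert (CF := cont_derive F F' dF).
assert (CH : forall x, p <= x <= r -> continuous H x).
{ intros x Hx; apply (ex_derive_continuous (V := R_NormedModule) H); exists (H' x); auto. }
set (B x := H' x * F x ^ 2 + H x * (2 * F x * F' x)).
assert (IB : is_RInt B p r 0).
{ replace 0 with (minus (H r * F r ^ 2) (H p * F p ^ 2))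
    by (rewrite Fp, Fr; unfold minus, plus, opp; simpl; ring).
  apply (is_RInt_derive (fun x => H x * F x ^ 2) B);
    rewrite Rmin_left, Rmax_right by auto; intros x Hx.
  - unfold B. evar_last.
    apply (is_derive_mult H (fun x => F x ^ 2) x (H' x) (2 * F x * F' x)); auto.
    + evar_last. apply (is_derive_pow F 2); apply dF. simpl; ring.
    + intros; apply Rmult_comm.
    + unfold plus, mult; simpl; ring.
  - apply (continuous_plus (V := R_NormedModule));
      apply (continuous_mult (K := R_AbsRing)); auto.
    + now apply (cont_sqr F).
    + revert x Hx; enough (C : cont (fun x => 2 * F x * F' x)) by auto; cont_tac. }
assert (X : forall (f : R -> R), (forall x, p <= x <= r -> continuous f x) -> ex_RInt f p r).
{ intros f Hf; apply (ex_RInt_continuous f).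
  now rewrite Rmin_left, Rmax_right by auto. }
assert (E1 : ex_RInt (fun x => - (H' x + H x ^ 2) * F x ^ 2) p r).
{ apply X; intros x Hx; apply (continuous_mult (K := R_AbsRing)); [|now apply (cont_sqr F)].
  apply (continuous_opp (V := R_NormedModule)), (continuous_plus (V := R_NormedModule)); auto.
  apply (continuous_comp H (fun y => y ^ 2)); auto.
  apply (cont_sqr (fun y : R => y)), cont_id. }
assert (E2 : ex_RInt (fun x => F' x ^ 2) p r) by (apply cont_ex_RInt; cont_tac).
assert (EB : ex_RInt B p r) by (eexists; exact IB).
assert (EP := RInt_plus _ B p r E1 EB); rewrite (is_RInt_unique _ _ _ _ IB) in EP.
change (RInt (fun x => - (H' x + H x ^ 2) * F x ^ 2 + B x) p r =
        RInt (fun x => - (H' x + H x ^ 2) * F x ^ 2) p r + 0) in EP.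
rewrite Rplus_0_r in EP; rewrite <- EP.
apply RInt_le; auto.
- now apply (ex_RInt_plus (V := R_NormedModule)).
- intros x _; unfold B.
  generalize (pow2_ge_0 (F' x - H x * F x)); lra.
Qed.

Definition phase (e t : R) : R := 2 * PI * t + e * sin (2 * PI * t).
(** The derivative of [phase e] divided by 2 PI. *)
Definition speed (e t : R) : R := 1 + e * cos (2 * PI * t).
(** One has 4 PI^2 [weight e] = phi'^2 + S / 2 for phi = [phase e] and its
    Schwarzian derivative S = phi''' / phi' - 3/2 (phi'' / phi')^2; this is
    the potential of the Hill equation solved by cos(phi) / sqrt(phi'). *)
Definition weight (e t : R) : R :=
  speed e t ^ 2 - e * cos (2 * PI * t) / (2 * speed e t)
  - 3 / 4 * (e * sin (2 * PI * t) / speed e t) ^ 2.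

Lemma sin_1_lipschitz (x y : R) : Rabs (sin x - sin y) <= Rabs (x - y).
Proof.
destruct (MVT_gen sin y x cos) as [c [_ Hc]].
- intros; apply is_derive_Reals, derivable_pt_lim_sin.
- intros; apply continuity_sin.
- rewrite Hc, Rabs_mult; rewrite <- (Rmult_1_l (Rabs (x - y))) at 2.
  apply Rmult_le_compat_r; [apply Rabs_pos|].
  apply Rabs_le, COS_bound.
Qed.

Lemma speed_bounds (e t : R) : 0 <= e <= 1 / 10 -> 9 / 10 <= speed e t <= 1 + e.
Proof. intros He; unfold speed; generalize (COS_bound (2 * PI * t)); nra. Qed.

Lemma phase_derive (e t : R) : is_derive (phase e) t (2 * PI * speed e t).
Proof. unfold phase, speed; auto_derive; [easy|ring]. Qed.

Lemma speed_derive (e t : R) : is_derive (speed e) t (- (2 * PI * (e * sin (2 * PI * t)))).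
Proof. unfold speed; auto_derive; [easy|ring]. Qed.

Lemma sin_cos_period (t : R) :
  sin (2 * PI * (t + 1)) = sin (2 * PI * t) /\ cos (2 * PI * (t + 1)) = cos (2 * PI * t).
Proof.
replace (2 * PI * (t + 1)) with (2 * PI * t + 2 * INR 1 * PI) by (simpl; ring).
split; [apply sin_period|apply cos_period].
Qed.

Lemma phase_period (e t : R) : phase e (t + 1) = phase e t + 2 * PI.
Proof. unfold phase; destruct (sin_cos_period t) as [-> _]; ring. Qed.

Lemma weight_period (e : R) : periodic (weight e).
Proof. intros t; unfold weight, speed; destruct (sin_cos_period t) as [-> ->]; ring. Qed.

Lemma phase_expand (e x y : R) : 0 <= e <= 1 / 10 -> x <= y ->
  9 / 10 * (2 * PI) * (y - x) <= phase e y - phase e x.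
Proof.
intros He xy; unfold phase.
assert (P := PI_RGT_0).
assert (L := sin_1_lipschitz (2 * PI * y) (2 * PI * x)).
rewrite (Rabs_pos_eq (2 * PI * y - 2 * PI * x)) in L by nra.
apply Rabs_le_between in L.
set (A := sin (2 * PI * y) - sin (2 * PI * x)) in *.
assert (0 <= 2 * PI * y - 2 * PI * x) by nra.
replace (2 * PI * y + e * sin (2 * PI * y) - (2 * PI * x + e * sin (2 * PI * x)))
  with (2 * PI * y - 2 * PI * x + e * A) by (unfold A; ring).
nra.
Qed.

Lemma cont_weight (e : R) : 0 <= e <= 1 / 10 -> cont (weight e).
Proof.
intros He t; apply (ex_derive_continuous (V := R_NormedModule) (weight e)).
assert (B := speed_bounds e t He); unfold weight, speed in *; auto_derive.
repeat split; lra.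
Qed.

(** The natural positive solution cos (phi - m) / sqrt(phi'), where m is the
    phase in the middle of the arc, vanishes at both ends of the arc.  Slowing
    its phase down to k (phi - m) with k < 1 makes it positive on the closed
    arc, so that [riccati_dirichlet] applies; this lowers the potential by (1
    - k^2) phi'^2 only, and k tends to 1. *)
Lemma weight_dirichlet (e p r : R) (F F' : R -> R) : 0 <= e <= 1 / 10 -> p <= r ->
  phase e r = phase e p + PI ->
  (forall x, is_derive F x (F' x)) -> cont F' -> F p = 0 -> F r = 0 ->
  RInt (fun x => 4 * PI ^ 2 * (weight e x * F x ^ 2)) p r <= RInt (fun x => F' x ^ 2) p r.
Proof.
intros He pr Hg dF CF' Fp Fr.
assert (P := PI_RGT_0).
assert (CF := cont_derive F F' dF).
assert (Cw := cont_weight e He).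
assert (Cg : cont (speed e)) by (eapply cont_derive, speed_derive).
set (m := phase e p + PI / 2).
set (Y := RInt (fun x => F' x ^ 2) p r).
set (X := RInt (fun x => 4 * PI ^ 2 * (weight e x * F x ^ 2)) p r).
set (K := RInt (fun x => 4 * PI ^ 2 * (speed e x ^ 2 * F x ^ 2)) p r).
assert (HK : forall k, 0 <= k < 1 -> X - (1 - k ^ 2) * K <= Y).
{ intros k Hk.
  (* H is the logarithmic derivative of cos (k (phi - m)) / sqrt(phi'), and H' its
     derivative. *)
  set (s x := e * sin (2 * PI * x)); set (c x := e * cos (2 * PI * x)).
  set (u x := k * (phase e x - m)).
  set (H x := - k * (2 * PI * speed e x) * (sin (u x) / cos (u x)) + PI * (s x / speed e x)).
  set (H' x := k * (2 * PI * (2 * PI * s x)) * (sin (u x) / cos (u x))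
     - (k * (2 * PI * speed e x)) ^ 2 * (1 + (sin (u x) / cos (u x)) ^ 2)
     + PI * (2 * PI * c x / speed e x + s x * (2 * PI * s x) / speed e x ^ 2)).
  assert (Hu : forall x, p <= x <= r -> 0 < cos (u x)).
  { intros x Hx.
    assert (G1 := phase_expand e p x He (proj1 Hx)).
    assert (G2 := phase_expand e x r He (proj2 Hx)).
    assert (0 <= 9 / 10 * (2 * PI) * (x - p)) by (apply Rmult_le_pos; lra).
    assert (0 <= 9 / 10 * (2 * PI) * (r - x)) by (apply Rmult_le_pos; lra).
    assert (M : - (PI / 2) <= phase e x - m <= PI / 2) by (unfold m; lra).
    apply cos_gt_0; unfold u; nra. }
  assert (Hg1 : forall x, 0 < speed e x) by (intros x; generalize (speed_bounds e x He); lra).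
  unfold X, K; rewrite <- int_scal by cont_tac.
  rewrite <- int_minus by cont_tac.
  rewrite <- (RInt_ext (fun x => - (H' x + H x ^ 2) * F x ^ 2)).
  - apply riccati_dirichlet; auto.
    + intros x Hx; unfold H, H', s, c, u, phase, speed in *.
      specialize (Hu x Hx); specialize (Hg1 x); unfold Rminus in *.
      auto_derive.
      * repeat split; lra.
      * field; lra.
    + intros x Hx; apply (ex_derive_continuous (V := R_NormedModule) H').
      unfold H', s, c, u, phase, speed in *.
      specialize (Hu x Hx); specialize (Hg1 x); unfold Rminus in *.
      auto_derive; repeat split; try lra.
      apply (pow_nonzero _ 2); lra.
  - intros x Hx; rewrite Rmin_left, Rmax_right in Hx by auto.
    assert (0 < cos (u x)) by (apply Hu; lra); specialize (Hg1 x).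
    unfold H, H', weight; fold (s x) (c x).
    match goal with |- ?l = ?r => change (@eq R l r) end; field; lra. }
(* If X exceeded Y, then k = 1 - d would contradict HK, d being so small that
   2 d |K| < X - Y. *)
destruct (Rle_lt_dec X Y) as [|XY]; auto; exfalso.
set (d := Rmin 1 ((X - Y) / (4 * (Rabs K + 1)))).
assert (AK := Rabs_pos K).
assert (d1 : d <= 1) by apply Rmin_l.
assert (d2 : d <= (X - Y) / (4 * (Rabs K + 1))) by apply Rmin_r.
assert (d0 : 0 < d) by (apply Rmin_glb_lt; [|apply Rdiv_lt_0_compat]; lra).
assert (d3 : d * (4 * (Rabs K + 1)) <= X - Y).
{ apply Rle_trans with ((X - Y) / (4 * (Rabs K + 1)) * (4 * (Rabs K + 1))).
  - apply Rmult_le_compat_r; lra.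
  - right; field; lra. }
specialize (HK (1 - d) ltac:(lra)).
assert (J : 0 <= 1 - (1 - d) ^ 2 <= 2 * d) by nra.
set (j := 1 - (1 - d) ^ 2) in *; generalize (Rle_abs K); intros.
assert (j * K <= j * Rabs K) by (apply Rmult_le_compat_l; lra).
assert (j * Rabs K <= 2 * d * Rabs K) by (apply Rmult_le_compat_r; lra).
nra.
Qed.

Lemma weight_pos (e t : R) : 0 <= e <= 1 / 10 -> 0 < weight e t <= 1 + 3 * e.
Proof.
intros He.
assert (B := speed_bounds e t He).
assert (S2 := SIN_bound (2 * PI * t)); assert (C2 := COS_bound (2 * PI * t)).
unfold weight; set (s := sin _) in *; set (c := cos _) in *; set (g := speed e t) in *.
assert (I : 0 < / g <= 10 / 9).
{ split; [apply Rinv_0_lt_compat; lra|].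
  replace (10 / 9) with (/ (9 / 10)) by field; apply Rinv_le_contravar; lra. }
replace (e * c / (2 * g)) with (e * c * / g / 2) by (field; lra).
replace (e * s / g) with (e * s * / g) by (field; lra).
set (i := / g) in *.
assert (A1 : - e <= e * c <= e) by nra.
assert (A2 : - e <= e * s <= e) by nra.
assert (A3 : - (10 / 9 * e) <= e * c * i <= 10 / 9 * e) by nra.
assert (A4 : - (10 / 9 * e) <= e * s * i <= 10 / 9 * e) by nra.
assert (A5 : 0 <= (e * s * i) ^ 2 <= 1 / 81) by nra.
split; nra.
Qed.

Lemma weight_0 (t : R) : weight 0 t = 1.
Proof. unfold weight, speed; field. Qed.

(** * The weighted Wirtinger inequality on the circle *)

(** T moves a point forward by half a turn of the phase.  It exists by the
    intermediate value theorem, and it is Lipschitz because the phase is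
    bi-Lipschitz. *)
Lemma antipode (e : R) : 0 <= e <= 1 / 10 -> exists T : R -> R,
  cont T /\ (forall t, t <= T t) /\ (forall t, phase e (T t) = phase e t + PI) /\
  (forall t, T (T t) = t + 1).
Proof.
intros He.
assert (P := PI_RGT_0).
assert (Cg : cont (phase e)) by (eapply cont_derive, phase_derive).
assert (X : forall t, exists r, t <= r /\ phase e r = phase e t + PI).
{ intros t.
  destruct (IVT_gen (phase e) t (t + 1) (phase e t + PI)) as [r [Hr E]].
  - intros x; apply continuity_pt_filterlim, Cg.
  - rewrite phase_period, Rmin_left, Rmax_right; lra.
  - exists r; rewrite Rmin_left in Hr by lra; intuition. }
destruct (choice (fun t r => t <= r /\ phase e r = phase e t + PI) X) as [T HT].
assert (inj : forall x y, phase e x = phase e y -> x = y).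
{ intros x y E; destruct (Rle_dec x y) as [L|L].
  - generalize (phase_expand e x y He L); rewrite E; nra.
  - generalize (phase_expand e y x He ltac:(lra)); rewrite E; nra. }
assert (incr : forall x y, phase e x <= phase e y -> x <= y).
{ intros x y E; destruct (Rle_dec x y) as [L|L]; auto.
  generalize (phase_expand e y x He ltac:(lra)); nra. }
assert (lip : forall x y, x <= y -> phase e y - phase e x <= 2 * (2 * PI) * (y - x)).
{ intros x y xy.
  assert (L := sin_1_lipschitz (2 * PI * y) (2 * PI * x)).
  rewrite (Rabs_pos_eq (2 * PI * y - 2 * PI * x)) in L by nra.
  apply Rabs_le_between in L.
  unfold phase; nra. }
assert (lipT : forall x y, x <= y -> 0 <= T y - T x <= 20 / 9 * (y - x)).
{ intros x y xy.
  assert (M : T x <= T y).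
  { apply incr; rewrite (proj2 (HT x)), (proj2 (HT y)).
    generalize (phase_expand e x y He xy); nra. }
  split; [lra|].
  assert (E := phase_expand e (T x) (T y) He M).
  rewrite (proj2 (HT x)), (proj2 (HT y)) in E.
  assert (L := lip x y xy).
  assert (2 * PI * (9 / 10 * (T y - T x)) <= 2 * PI * (2 * (y - x))) by lra.
  apply (Rmult_le_reg_l (2 * PI)); lra. }
exists T; repeat split; try apply HT.
- intros x; apply continuity_pt_filterlim; intros eps Heps.
  exists (eps / 3); split; [lra|].
  intros y [_ Hy]; simpl in *; unfold R_dist in *; apply Rabs_def2 in Hy.
  apply Rabs_def1; destruct (Rle_dec x y) as [L|L];
    first [generalize (lipT x y L) | generalize (lipT y x ltac:(lra))]; lra.
- intros t; apply inj; rewrite phase_period, !(proj2 (HT _)); lra.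
Qed.

(** The difference of f and f o T changes sign between 0 and T 0, so f takes
    the same value c at some z and at T z.  Then f - c vanishes at the ends of
    the arcs from z to T z and from T z to z + 1, and [weight_dirichlet]
    applies on both.  As f has weighted mean zero, subtracting c can only
    increase the weighted integral of the square. *)
Lemma wirtinger (e : R) (f f' : R -> R) : 0 <= e <= 1 / 10 ->
  (forall x, is_derive f x (f' x)) -> cont f' -> periodic f -> periodic f' ->
  RInt (fun x => weight e x * f x) 0 1 = 0 ->
  4 * PI ^ 2 * RInt (fun x => weight e x * f x ^ 2) 0 1 <= RInt (fun x => f' x ^ 2) 0 1.
Proof.
intros He df Cf' Pf Pf' H0.
assert (Cf := cont_derive f f' df).
assert (Cw := cont_weight e He).
destruct (antipode e He) as (T & CT & T1 & T2 & T3).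
set (D t := f t - f (T t)).
assert (CD : cont D) by (unfold D; cont_tac).
assert (Hz : exists z, f (T z) = f z).
{ destruct (IVT_cor D 0 (T 0)) as [z [_ Hz]].
  - intros x; apply continuity_pt_filterlim, CD.
  - apply T1.
  - unfold D; rewrite T3, Pf; generalize (pow2_ge_0 (f 0 - f (T 0))); lra.
  - exists z; unfold D in Hz; lra. }
destruct Hz as [z Hz].
set (c := f z); set (F x := f x - c).
assert (dF : forall x, is_derive F x (f' x)).
{ intros x; unfold F; evar_last; [apply (is_derive_minus f (fun _ => c))|].
  apply df. apply is_derive_const. unfold minus, plus, opp, zero; simpl; ring. }
assert (CF := cont_derive F f' dF).
assert (I1 := weight_dirichlet e z (T z) F f' He (T1 z) (T2 z) dF Cf').
assert (I2 := weight_dirichlet e (T z) (T (T z)) F f' He (T1 _) (T2 _) dF Cf').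
rewrite T3 in I2; unfold F in I1 at 1 2, I2 at 1 2; rewrite Pf, Hz in I2; rewrite Hz in I1.
specialize (I1 (Rminus_diag _) (Rminus_diag _)); specialize (I2 (Rminus_diag _) (Rminus_diag _)).
assert (I := Rplus_le_compat _ _ _ _ I1 I2).
rewrite !int_Chasles in I by cont_tac.
rewrite !int_period in I.
2,4: cont_tac.
3: { intros x; unfold F; now rewrite weight_period, Pf. }
2: { intros x; now rewrite Pf'. }
rewrite int_scal in I by cont_tac.
apply Rle_trans with (2 := I); apply Rmult_le_compat_l; [nra|].
rewrite (int_ext (fun x => weight e x * F x ^ 2)
  (fun x => (weight e x * f x ^ 2 - 2 * c * (weight e x * f x)) + c ^ 2 * weight e x))
  by (intros; unfold F; ring).
rewrite int_plus, int_minus, !int_scal, H0 by cont_tac.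
assert (0 <= RInt (weight e) 0 1) by (apply int_ge_0; auto; [lra|]; intros x; generalize (weight_pos e x He); lra).
nra.
Qed.

Lemma wirtinger_flat (f f' : R -> R) :
  (forall x, is_derive f x (f' x)) -> cont f' -> periodic f -> periodic f' ->
  4 * PI ^ 2 * (RInt (fun x => f x ^ 2) 0 1 - RInt f 0 1 ^ 2) <= RInt (fun x => f' x ^ 2) 0 1.
Proof.
intros df Cf' Pf Pf'.
assert (Cf := cont_derive f f' df).
set (c := RInt f 0 1).
assert (W := wirtinger 0 (fun x => f x - c) f').
rewrite (int_ext (fun x => weight 0 x * (f x - c)) (fun x => f x - c)) in W by (intros; rewrite weight_0; ring).
rewrite (int_ext (fun x => weight 0 x * (f x - c) ^ 2) (fun x => (f x ^ 2 - 2 * c * f x) + c ^ 2)) in W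
  by (intros; rewrite weight_0; ring).
rewrite int_plus, !int_minus, int_scal, !int_const in W by cont_tac.
fold c in W.
replace (RInt (fun x => f x ^ 2) 0 1 - c ^ 2)
  with (RInt (fun x => f x ^ 2) 0 1 - 2 * c * c + (1 - 0) * c ^ 2) by ring.
apply W; auto; try lra.
- intros x; evar_last; [apply (is_derive_minus f (fun _ => c))|].
  apply df. apply is_derive_const. unfold minus, plus, opp, zero; simpl; ring.
- intros x; now rewrite Pf.
Qed.

(** * Double integrals of periodic functions *)

Definition int2 (f : R -> R -> R) : R := RInt (fun t => RInt (fun s => f s t) 0 1) 0 1.

Lemma int2_ext (f g : R -> R -> R) : (forall s t, f s t = g s t) -> int2 f = int2 g.
Proof. intros E; apply int_ext; intros t; apply int_ext; auto. Qed.

Lemma cont_int_s (f : R -> R -> R) : cont2 f -> cont (fun t : R => RInt (fun s => f s t) 0 1).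
Proof. apply cont_int_param; lra. Qed.

Lemma cont_int_t (f : R -> R -> R) : cont2 f -> cont (fun s : R => RInt (fun t => f s t) 0 1).
Proof. intros H; apply (cont_int_s (fun t s => f s t)); cont_tac. Qed.

Lemma int2_plus (f g : R -> R -> R) : cont2 f -> cont2 g ->
  int2 (fun s t => f s t + g s t) = int2 f + int2 g.
Proof.
intros Hf Hg; unfold int2; rewrite <- int_plus by (now apply cont_int_s).
apply int_ext; intros t; apply int_plus; cont_tac.
Qed.

Lemma int2_scal (c : R) (f : R -> R -> R) : cont2 f ->
  int2 (fun s t => c * f s t) = c * int2 f.
Proof.
intros Hf; unfold int2; rewrite <- int_scal by (now apply cont_int_s).
apply int_ext; intros t; apply (int_scal (fun s => f s t)); cont_tac.
Qed.

Lemma int2_minus (f g : R -> R -> R) : cont2 f -> cont2 g ->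
  int2 (fun s t => f s t - g s t) = int2 f - int2 g.
Proof.
intros Hf Hg; unfold int2; rewrite <- int_minus by (now apply cont_int_s).
apply int_ext; intros t; apply int_minus; cont_tac.
Qed.

Lemma int2_le (f g : R -> R -> R) : cont2 f -> cont2 g ->
  (forall s t, f s t <= g s t) -> int2 f <= int2 g.
Proof.
intros Hf Hg H; apply int_le; [lra|now apply cont_int_s..|].
intros t; apply int_le; [lra|cont_tac..|auto].
Qed.

Lemma int2_ge_0 (f : R -> R -> R) : cont2 f -> (forall s t, 0 <= f s t) -> 0 <= int2 f.
Proof.
intros Hf H; apply int_ge_0; [lra|now apply cont_int_s|].
intros t; apply int_ge_0; [lra|cont_tac|auto].
Qed.

Lemma int2_s_out (c : R -> R) (f : R -> R -> R) : cont2 f ->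
  int2 (fun s t => c t * f s t) = RInt (fun t => c t * RInt (fun s => f s t) 0 1) 0 1.
Proof. intros H; apply int_ext; intros t; apply (int_scal (fun s => f s t)); cont_tac. Qed.

Lemma int2_t (c : R -> R) : int2 (fun _ t => c t) = RInt c 0 1.
Proof. apply int_ext; intros t; rewrite int_const; ring. Qed.

Lemma int2_swap (f : R -> R -> R) : cont2 f ->
  int2 f = RInt (fun s => RInt (fun t => f s t) 0 1) 0 1.
Proof. apply fubini. Qed.

Lemma int2_t_out (c : R -> R) (f : R -> R -> R) : cont c -> cont2 f ->
  int2 (fun s t => c s * f s t) = RInt (fun s => c s * RInt (fun t => f s t) 0 1) 0 1.
Proof.
intros Hc H; rewrite int2_swap by cont_tac; apply int_ext; intros s.
apply (int_scal (fun t => f s t)); cont_tac.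
Qed.

Definition periodic2 (f : R -> R -> R) : Prop :=
  (forall s t, f (s + 1) t = f s t) /\ (forall s t, f s (t + 1) = f s t).

(** The shear (s, t) -> (s - t, t) is an automorphism of the torus; it turns
    the direction (0,1) into (-1,1). *)
Lemma int2_shear (f : R -> R -> R) : cont2 f -> (forall s t, f (s + 1) t = f s t) ->
  int2 (fun s t => f (s - t) t) = int2 f.
Proof.
intros H P; apply int_ext; intros t.
apply (int_period_shift (fun s => f s t)); [cont_tac|]; intros s; apply P.
Qed.

(** * Functions with a continuous gradient *)

(** Differentiability is carried along with the continuous partial
    derivatives, so that the chain rule is available for oblique coordinates. *)
Definition has_gradient (U Us Ut : R -> R -> R) : Prop :=
  cont2 Us /\ cont2 Ut /\ forall s t, differentiable_pt_lim U s t (Us s t) (Ut s t).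

Lemma gradient_intro (U Us Ut : R -> R -> R) :
  (forall s t, is_derive (fun z => U z t) s (Us s t)) ->
  (forall s t, is_derive (fun z => U s z) t (Ut s t)) ->
  cont2 Us -> cont2 Ut -> has_gradient U Us Ut.
Proof.
intros Ds Dt Cs Ct; split; [auto|split; [auto|]]; intros s t.
apply filterdiff_differentiable_pt_lim.
apply (is_derive_filterdiff U s t Us (Ut s t)); auto.
exists (mkposreal 1 Rlt_0_1); intros; apply Ds.
Qed.

Lemma gradient_cont (U Us Ut : R -> R -> R) : has_gradient U Us Ut -> cont2 U.
Proof.
intros (_ & _ & H); apply cont2_pt; intros; apply differentiable_continuity_pt.
eexists; eexists; apply H.
Qed.

Lemma gradient_comp (U Us Ut : R -> R -> R) (f g : R -> R) (f1 g1 x : R) : has_gradient U Us Ut ->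
  is_derive f x f1 -> is_derive g x g1 ->
  is_derive (fun z => U (f z) (g z)) x (Us (f x) (g x) * f1 + Ut (f x) (g x) * g1).
Proof.
intros (_ & _ & H) df dg; apply is_derive_Reals, derivable_pt_lim_comp_2d;
  [apply H|now apply is_derive_Reals..].
Qed.

Lemma gradient_s (U Us Ut : R -> R -> R) : has_gradient U Us Ut ->
  forall s t, is_derive (fun z => U z t) s (Us s t).
Proof.
intros H s t; evar_last.
- apply (gradient_comp U Us Ut (fun z => z) (fun _ => t) 1 0 s H); [apply (is_derive_id s)|apply (is_derive_const t s)].
- cbv beta; ring.
Qed.

Lemma gradient_t (U Us Ut : R -> R -> R) : has_gradient U Us Ut ->
  forall s t, is_derive (fun z => U s z) t (Ut s t).
Proof.
intros H s t; evar_last.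
- apply (gradient_comp U Us Ut (fun _ => s) (fun z => z) 0 1 t H); [apply (is_derive_const s t)|apply (is_derive_id t)].
- cbv beta; ring.
Qed.

Lemma derive_shift (f : R -> R) (x c l : R) :
  is_derive f (x + c) l -> is_derive (fun z => f (z + c)) x l.
Proof.
intros H; evar_last; [apply (is_derive_comp f (fun z => z + c) x l 1 H)|].
- auto_derive; auto; ring.
- unfold scal; simpl; unfold mult; simpl; ring.
Qed.

Lemma gradient_periodic (U Us Ut : R -> R -> R) : has_gradient U Us Ut -> periodic2 U ->
  periodic2 Us /\ periodic2 Ut.
Proof.
intros H [P Q]; repeat split; intros s t.
- rewrite <- (is_derive_unique _ _ _ (gradient_s _ _ _ H s t)); symmetry; apply is_derive_unique.
  apply (is_derive_ext (fun z => U (z + 1) t)); [intros; apply P|].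
  apply (derive_shift (fun z => U z t)), (gradient_s _ _ _ H).
- rewrite <- (is_derive_unique _ _ _ (gradient_s _ _ _ H s t)); symmetry; apply is_derive_unique.
  apply (is_derive_ext (fun z => U z (t + 1))); [intros; apply Q|].
  apply (gradient_s _ _ _ H).
- rewrite <- (is_derive_unique _ _ _ (gradient_t _ _ _ H s t)); symmetry; apply is_derive_unique.
  apply (is_derive_ext (fun z => U (s + 1) z)); [intros; apply P|].
  apply (gradient_t _ _ _ H).
- rewrite <- (is_derive_unique _ _ _ (gradient_t _ _ _ H s t)); symmetry; apply is_derive_unique.
  apply (is_derive_ext (fun z => U s (z + 1))); [intros; apply Q|].
  apply (derive_shift (fun z => U s z)), (gradient_t _ _ _ H).
Qed.

(** * Poincare inequalities on the torus *)

Lemma poincare_s (U Us Ut : R -> R -> R) : has_gradient U Us Ut -> periodic2 U ->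
  (forall t, RInt (fun s => U s t) 0 1 = 0) ->
  4 * PI ^ 2 * int2 (fun s t => U s t ^ 2) <= int2 (fun s t => Us s t ^ 2).
Proof.
intros H P Z.
assert (CU := gradient_cont _ _ _ H); assert (PU := gradient_periodic _ _ _ H P).
assert (CUs := proj1 H).
rewrite <- int2_scal by cont_tac.
apply int_le; [lra|apply cont_int_s; cont_tac..|].
intros t; rewrite (int_scal (fun s => U s t ^ 2)) by cont_tac.
generalize (wirtinger_flat (fun s => U s t) (fun s => Us s t)); rewrite Z; intros W.
rewrite pow_i, Rminus_0_r in W by auto with arith.
apply W; [apply (fun s => gradient_s _ _ _ H s t)|cont_tac|intros s; apply P|intros s; apply PU].
Qed.

Lemma poincare_t (U Ut : R -> R -> R) : cont2 U -> cont2 Ut ->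
  (forall s t, is_derive (fun z => U s z) t (Ut s t)) ->
  (forall s, periodic (fun t => U s t)) -> (forall s, periodic (fun t => Ut s t)) ->
  4 * PI ^ 2 * (int2 (fun s t => U s t ^ 2) - RInt (fun s => RInt (fun t => U s t) 0 1 ^ 2) 0 1)
  <= int2 (fun s t => Ut s t ^ 2).
Proof.
intros CU CUt D P P'.
rewrite !int2_swap by cont_tac.
assert (C := cont_int_t U CU).
assert (C2 := cont_int_t (fun s t => U s t ^ 2) ltac:(cont_tac)).
rewrite <- int_minus, <- int_scal by cont_tac.
apply int_le; [lra|cont_tac|apply (cont_int_t (fun s t => Ut s t ^ 2)); cont_tac|].
intros s; apply wirtinger_flat; auto; cont_tac.
Qed.

(** The mean p over the vertical circles depends on s alone and the mean q
    over the sheared circles depends on s + t alone.  Both have mean zero, so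
    they are orthogonal as functions on the torus, and they are the orthogonal
    projections of V: the claim says that V - p(s) - q(s + t) has a
    nonnegative norm. *)
Lemma bessel (V : R -> R -> R) : cont2 V -> periodic2 V -> int2 V = 0 ->
  RInt (fun s => RInt (fun t => V s t) 0 1 ^ 2) 0 1
  + RInt (fun s => RInt (fun t => V (s - t) t) 0 1 ^ 2) 0 1
  <= int2 (fun s t => V s t ^ 2).
Proof.
intros CV [P Q] Z.
set (p := fun s => RInt (fun t => V s t) 0 1).
set (q := fun s => RInt (fun t => V (s - t) t) 0 1).
assert (Cp : cont p) by (apply cont_int_t; auto).
assert (CW : cont2 (fun s t => V (s - t) t)) by cont_tac.
assert (Cq : cont q) by (apply (cont_int_t _ CW)).
assert (Pq : periodic q).
{ intros s; apply int_ext; intros t.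
  replace (s + 1 - t) with (s - t + 1) by ring; apply P. }
change (RInt (fun s => p s ^ 2) 0 1 + RInt (fun s => q s ^ 2) 0 1 <= int2 (fun s t => V s t ^ 2)).
assert (E := int2_ge_0 (fun s t => (V s t - p s - q (s + t)) ^ 2)
  ltac:(cont_tac) ltac:(intros; apply pow2_ge_0)).
rewrite (int2_ext _ (fun s t => V s t ^ 2 + p s * p s + q (s + t) ^ 2
   - 2 * (p s * V s t) - 2 * (V s t * q (s + t)) + 2 * (p s * q (s + t)))) in E by (intros; ring).
rewrite int2_plus, !int2_minus, !int2_plus, !int2_scal in E by cont_tac.
assert (E1 : int2 (fun s _ => p s * p s) = RInt (fun s => p s ^ 2) 0 1).
{ rewrite int2_swap by cont_tac; apply int_ext; intros s; rewrite int_const; ring. }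
assert (E2 : int2 (fun s t => q (s + t) ^ 2) = RInt (fun s => q s ^ 2) 0 1).
{ unfold int2; rewrite (int_ext _ (fun _ => RInt (fun s => q s ^ 2) 0 1)).
  - rewrite int_const; ring.
  - intros t; apply (int_period_shift (fun s => q s ^ 2) t); [cont_tac|].
    intros s; now rewrite Pq. }
assert (E3 : int2 (fun s t => p s * V s t) = RInt (fun s => p s ^ 2) 0 1).
{ rewrite int2_t_out by auto; apply int_ext; intros s; unfold p; ring. }
assert (E4 : int2 (fun s t => V s t * q (s + t)) = RInt (fun s => q s ^ 2) 0 1).
{ rewrite <- int2_shear.
  - rewrite (int2_ext _ (fun s t => q s * V (s - t) t)).
    + rewrite (int2_t_out q _ Cq CW); apply int_ext; intros s; unfold q; ring.
    + intros s t; replace (s - t + t) with s by ring; ring.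
  - cont_tac.
  - intros s t; rewrite P; replace (s + 1 + t) with (s + t + 1) by ring; now rewrite Pq. }
assert (E5 : int2 (fun s t => p s * q (s + t)) = 0).
{ rewrite int2_t_out by cont_tac.
  rewrite (int_ext _ (fun s => RInt q 0 1 * p s)).
  - rewrite int_scal by auto.
    replace (RInt p 0 1) with (int2 V) by (apply int2_swap; auto); rewrite Z; ring.
  - intros s; rewrite (int_ext _ (fun t => q (t + s))) by (intros; f_equal; ring).
    rewrite int_period_shift by auto; ring. }
rewrite E1, E2, E3, E4, E5 in E; lra.
Qed.

(** In Fourier modes (m, n) the claim reads A m^2 + B n^2 + C (n - m)^2 >= A +
    C for m <> 0: the first term is at least A, and n = 0 and n = m cannot
    both hold.  The proof replaces the two alternatives by [bessel], which
    says that the means lost in the two applications of [poincare_t] amount to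
    at most one copy of the squared norm of V. *)
Lemma poincare_mean_zero (V Vs Vt : R -> R -> R) (A B C : R) :
  0 <= A -> 0 <= C <= B -> has_gradient V Vs Vt -> periodic2 V ->
  (forall t, RInt (fun s => V s t) 0 1 = 0) ->
  4 * PI ^ 2 * (A + C) * int2 (fun s t => V s t ^ 2) <=
  A * int2 (fun s t => Vs s t ^ 2) + B * int2 (fun s t => Vt s t ^ 2)
  + C * int2 (fun s t => (Vt s t - Vs s t) ^ 2).
Proof.
intros HA HBC H P Z.
assert (CV := gradient_cont _ _ _ H).
destruct (gradient_periodic _ _ _ H P) as [Ps Pt].
destruct (H) as (CVs & CVt & _).
assert (I1 := poincare_s V Vs Vt H P Z).
assert (I2 := poincare_t V Vt CV CVt (gradient_t _ _ _ H) (fun s t => proj2 P s t) (fun s t => proj2 Pt s t)).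
assert (I3 := poincare_t (fun s t => V (s - t) t) (fun s t => Vt (s - t) t - Vs (s - t) t)
  ltac:(cont_tac) ltac:(cont_tac)); cbv beta in I3.
destruct P as [P Q], Ps as [Ps Qs], Pt as [Pt Qt].
assert (back : forall f, (forall s t, f (s + 1) t = f s t) -> forall s t : R, f (s - (t + 1)) t = f (s - t) t :> R).
{ intros f Pf s t; rewrite <- Pf; f_equal; ring. }
rewrite (int2_shear (fun s t => V s t ^ 2)) in I3; [|cont_tac|intros; now rewrite P].
rewrite (int2_shear (fun s t => (Vt s t - Vs s t) ^ 2)) in I3; [|cont_tac|intros; now rewrite Ps, Pt].
assert (Z' : int2 V = 0).
{ unfold int2; rewrite (int_ext _ (fun _ => 0)) by auto; rewrite int_const; ring. }
assert (I4 := bessel V CV (conj P Q) Z').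
specialize (I3 ltac:(intros s t; evar_last;
   [apply (gradient_comp V Vs Vt (fun z => s - z) (fun z => z) (-1) 1 t H); auto_derive; auto; ring
   | cbv beta; ring])).
specialize (I3 ltac:(intros s t; rewrite Q; now apply back)).
specialize (I3 ltac:(intros s t; rewrite Qs, Qt, !back; auto)).
set (N := int2 (fun s t => V s t ^ 2)) in *.
assert (J := int2_ge_0 (fun s t => Vt s t ^ 2) ltac:(cont_tac) ltac:(intros; apply pow2_ge_0)).
set (X := int2 (fun s t => Vs s t ^ 2)) in *.
set (Y := int2 (fun s t => Vt s t ^ 2)) in *.
set (W := int2 (fun s t => (Vt s t - Vs s t) ^ 2)) in *.
assert (K : 4 * PI ^ 2 * N <= Y + W).
{ assert (0 <= 4 * PI ^ 2) by (generalize (pow2_ge_0 PI); lra). nra. }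
assert (A * (4 * PI ^ 2 * N) <= A * X) by (apply Rmult_le_compat_l; lra).
assert (C * (4 * PI ^ 2 * N) <= C * (Y + W)) by (apply Rmult_le_compat_l; lra).
assert (C * Y <= B * Y) by (apply Rmult_le_compat_r; lra).
lra.
Qed.

(** U is the sum of its mean c over the horizontal circles and of a remainder
    V; as the weight depends on t alone, the two are orthogonal in the
    weighted norm and in the energy.  [wirtinger] controls c with the sharp
    constant, and [poincare_mean_zero] controls V with the larger constant A +
    C, which absorbs the bound 1 + 3 e of the weight. *)
Lemma weighted_poincare (e A B C : R) (U Us Ut : R -> R -> R) :
  0 <= e <= 1 / 10 -> 0 <= A -> 0 <= C <= B -> (1 + 3 * e) * (B + C) <= A + C ->
  has_gradient U Us Ut -> periodic2 U -> int2 (fun s t => weight e t * U s t) = 0 ->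
  4 * PI ^ 2 * (B + C) * int2 (fun s t => weight e t * U s t ^ 2) <=
  int2 (fun s t => A * Us s t ^ 2 + B * Ut s t ^ 2 + C * (Ut s t - Us s t) ^ 2).
Proof.
intros He HA HBC HABC H P Z.
assert (CU := gradient_cont _ _ _ H).
destruct (gradient_periodic _ _ _ H P) as [Ps Pt].
destruct (H) as (CUs & CUt & _).
assert (Cw := cont_weight e He).
set (c := fun t => RInt (fun s => U s t) 0 1).
set (c' := fun t => RInt (fun s => Ut s t) 0 1).
assert (Cc : cont c) by now apply cont_int_s.
assert (Cc' : cont c') by now apply cont_int_s.
assert (dc : forall t, is_derive c t (c' t)).
{ apply derive_int_param; [apply (gradient_t _ _ _ H)|intros; cont_tac|auto]. }
assert (Pc : periodic c) by (intros t; apply int_ext; intros s; apply P).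
assert (Pc' : periodic c') by (intros t; apply int_ext; intros s; apply Pt).
assert (W := wirtinger e c c' He dc Cc' Pc Pc').
set (V := fun s t => U s t - c t).
set (Vt := fun s t => Ut s t - c' t).
assert (CVt : cont2 Vt) by (unfold Vt; cont_tac).
assert (HV : has_gradient V Us Vt).
{ apply gradient_intro; auto; intros s t; unfold V, Vt; evar_last.
  - apply (is_derive_minus (fun z => U z t) (fun _ => c t)).
    + apply (gradient_s _ _ _ H).
    + apply (is_derive_const (c t) s).
  - unfold minus, plus, opp, zero; simpl; ring.
  - apply (is_derive_minus (fun z => U s z) c); [apply (gradient_t _ _ _ H)|apply dc].
  - reflexivity. }
assert (PV : periodic2 V).
{ split; intros s t; unfold V; rewrite ?Pc; f_equal; apply P. }
assert (CV := gradient_cont _ _ _ HV).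
assert (ZV : forall t, RInt (fun s => V s t) 0 1 = 0).
{ intros t; unfold V; rewrite int_minus, int_const by cont_tac; fold (c t); real_eq; ring. }
assert (ZVt : forall t, RInt (fun s => Vt s t) 0 1 = 0).
{ intros t; unfold Vt; rewrite int_minus, int_const by cont_tac; fold (c' t); real_eq; ring. }
assert (ZUs : forall t, RInt (fun s => Us s t) 0 1 = 0).
{ intros t; rewrite (int_derive (fun s => U s t) (fun s => Us s t)).
  - rewrite <- (Rplus_0_l 1), (proj1 P); real_eq; ring.
  - intros s; apply (gradient_s _ _ _ H).
  - cont_tac. }
assert (M := poincare_mean_zero V Us Vt A B C HA HBC HV PV ZV).
assert (ortho : forall (k : R -> R) (f : R -> R -> R), cont2 f ->
  (forall t, RInt (fun s => f s t) 0 1 = 0) -> int2 (fun s t => k t * f s t) = 0).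
{ intros k f Hf E; rewrite int2_s_out by auto.
  rewrite (int_ext _ (fun _ => 0)) by (intros; rewrite E; ring).
  rewrite int_const; ring. }
assert (Zc : RInt (fun t => weight e t * c t) 0 1 = 0) by
  (etransitivity; [symmetry; exact (int2_s_out (weight e) U CU)|exact Z]).
specialize (W Zc).
assert (E1 : int2 (fun s t => weight e t * U s t ^ 2) =
  int2 (fun s t => weight e t * V s t ^ 2) + RInt (fun t => weight e t * c t ^ 2) 0 1).
{ rewrite (int2_ext _ (fun s t => weight e t * V s t ^ 2 + weight e t * c t ^ 2 + (2 * weight e t * c t) * V s t))
    by (intros; unfold V; ring).
  rewrite !int2_plus, int2_t, (ortho (fun t => 2 * weight e t * c t)) by (auto; cont_tac); ring. }
assert (E2 : int2 (fun s t => Ut s t ^ 2) =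
  int2 (fun s t => Vt s t ^ 2) + RInt (fun t => c' t ^ 2) 0 1).
{ rewrite (int2_ext _ (fun s t => Vt s t ^ 2 + c' t ^ 2 + (2 * c' t) * Vt s t))
    by (intros; unfold Vt; ring).
  rewrite !int2_plus, int2_t, (ortho (fun t => 2 * c' t)) by (auto; cont_tac); ring. }
assert (E3 : int2 (fun s t => (Ut s t - Us s t) ^ 2) =
  int2 (fun s t => (Vt s t - Us s t) ^ 2) + RInt (fun t => c' t ^ 2) 0 1).
{ rewrite (int2_ext _ (fun s t => (Vt s t - Us s t) ^ 2 + c' t ^ 2
     + (2 * c' t) * Vt s t - (2 * c' t) * Us s t))
    by (intros; unfold Vt; ring).
  rewrite int2_minus, !int2_plus, int2_t, !(ortho (fun t => 2 * c' t)) by (auto; cont_tac); ring. }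
rewrite !int2_plus, !int2_scal, E1, E2, E3 by cont_tac.
assert (L : int2 (fun s t => weight e t * V s t ^ 2) <= (1 + 3 * e) * int2 (fun s t => V s t ^ 2)).
{ rewrite <- int2_scal by cont_tac; apply int2_le; [cont_tac..|].
  intros s t; apply Rmult_le_compat_r; [apply pow2_ge_0|apply weight_pos; auto]. }
assert (N0 := int2_ge_0 (fun s t => V s t ^ 2) ltac:(cont_tac) ltac:(intros; apply pow2_ge_0)).
set (N := int2 (fun s t => V s t ^ 2)) in *.
set (Nw := int2 (fun s t => weight e t * V s t ^ 2)) in *.
assert (PP : 0 <= 4 * PI ^ 2) by (generalize (pow2_ge_0 PI); lra).
assert (L1 : (B + C) * Nw <= (A + C) * N).
{ apply Rle_trans with ((B + C) * ((1 + 3 * e) * N)); [apply Rmult_le_compat_l; lra|].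
  replace ((B + C) * ((1 + 3 * e) * N)) with ((1 + 3 * e) * (B + C) * N) by ring.
  apply Rmult_le_compat_r; lra. }
assert (L2 := Rmult_le_compat_l _ _ _ PP L1).
assert (L3 := Rmult_le_compat_l (B + C) _ _ ltac:(lra) W).
lra.
Qed.

Lemma int2_zero (f : R -> R -> R) : cont2 f -> periodic2 f ->
  (forall s t, 0 <= f s t) -> int2 f = 0 -> forall s t, f s t = 0.
Proof.
intros C [P Q] H0 Z s t.
refine (periodic_zero (fun s => f s t) _ _ (fun s => H0 s t) _ s); [cont_tac|intros z; apply P|].
refine (periodic_zero (fun t => RInt (fun s => f s t) 0 1) _ _ _ Z t).
- now apply cont_int_s.
- intros z; apply int_ext; auto.
- intros z; apply int_ge_0; [lra|cont_tac|auto].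
Qed.

Lemma int2_derivatives (U Us Ut : R -> R -> R) : has_gradient U Us Ut -> periodic2 U ->
  int2 Us = 0 /\ int2 Ut = 0.
Proof.
intros H P; destruct (H) as (Cs & Ct & _).
split; [|rewrite int2_swap by auto]; unfold int2;
  rewrite (int_ext _ (fun _ => 0)); try (rewrite int_const; ring).
- intros t; rewrite (int_derive (fun s => U s t) (fun s => Us s t)).
  + rewrite <- (Rplus_0_l 1), (proj1 P); real_eq; ring.
  + intros s; apply (gradient_s _ _ _ H).
  + cont_tac.
- intros s; rewrite (int_derive (fun t => U s t) (fun t => Ut s t)).
  + rewrite <- (Rplus_0_l 1), (proj2 P); real_eq; ring.
  + intros t; apply (gradient_t _ _ _ H).
  + cont_tac.
Qed.

Lemma gradient_mult (f fx fy g gx gy : R -> R -> R) : has_gradient f fx fy -> has_gradient g gx gy ->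
  has_gradient (fun x y => f x y * g x y) (fun x y => fx x y * g x y + f x y * gx x y)
     (fun x y => fy x y * g x y + f x y * gy x y).
Proof.
intros Hf Hg; assert (Cf := gradient_cont _ _ _ Hf); assert (Cg := gradient_cont _ _ _ Hg).
destruct (Hf) as (Cfx & Cfy & _); destruct (Hg) as (Cgx & Cgy & _).
apply gradient_intro; try cont_tac; intros s t.
- apply (is_derive_mult (fun z => f z t) (fun z => g z t));
    [apply (gradient_s _ _ _ Hf)|apply (gradient_s _ _ _ Hg)|intros; apply Rmult_comm].
- apply (is_derive_mult (fun z => f s z) (fun z => g s z));
    [apply (gradient_t _ _ _ Hf)|apply (gradient_t _ _ _ Hg)|intros; apply Rmult_comm].
Qed.

Lemma Ck1_gradient (f : R -> R -> R) : Ck 1 f -> has_gradient f (dx f) (dy f).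
Proof.
intros (D & Cx & Cy). apply gradient_intro.
- (intros s t; apply (Derive_correct (fun z => f z t)); apply (D s t)).
- (intros s t; apply (Derive_correct (fun z => f s z)); apply (D s t)).
- exact (proj2 (cont2_pt (dx f)) Cx).
- exact (proj2 (cont2_pt (dy f)) Cy).
Qed.

(** * Green's formula on the lattice torus *)

(** The function f in the coordinates (s, t) of the lattice basis (1,0),
    (a,b). *)
Definition lift (a b : R) (f : R -> R -> R) (s t : R) : R := f (s + t * a) (t * b).

Lemma gradient_lift (a b : R) (f fx fy : R -> R -> R) : has_gradient f fx fy ->
  has_gradient (lift a b f) (lift a b fx) (fun s t => a * lift a b fx s t + b * lift a b fy s t).
Proof.
intros H; destruct (H) as (Cx & Cy & _); unfold lift.
apply gradient_intro; try cont_tac; intros s t; evar_last.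
- apply (gradient_comp f fx fy (fun z => z + t * a) (fun _ => t * b) 1 0 s H); auto_derive; auto.
- cbv beta; ring.
- apply (gradient_comp f fx fy (fun z => s + z * a) (fun z => z * b) a b t H); auto_derive; auto; ring.
- cbv beta; ring.
Qed.

Definition invariant (a b : R) (f : R -> R -> R) : Prop :=
  forall u v, Gamma a b u v -> forall x y, f (x + u) (y + v) = f x y.

Lemma lift_periodic (a b : R) (f : R -> R -> R) : invariant a b f -> periodic2 (lift a b f).
Proof.
intros H; split; intros s t; unfold lift.
- assert (G : Gamma a b 1 0) by (exists 1%Z, 0%Z; split; ring).
  rewrite <- (H 1 0 G (s + t * a)); f_equal; ring.
- assert (G : Gamma a b a b) by (exists 0%Z, 1%Z; split; ring).
  rewrite <- (H a b G (s + t * a)); f_equal; ring.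
Qed.

Lemma lift_surj (a b : R) (f : R -> R -> R) (x y : R) : b <> 0 ->
  f x y = lift a b f (x - y / b * a) (y / b).
Proof. intros hb; unfold lift; f_equal; field; auto. Qed.

Lemma invariant_dx (a b : R) (f : R -> R -> R) : invariant a b f -> invariant a b (dx f).
Proof.
intros H u v G x y; unfold dx, Derive; f_equal; apply Lim_ext; intros h.
replace (x + u + h) with (x + h + u) by ring; now rewrite !H.
Qed.

Lemma invariant_dy (a b : R) (f : R -> R -> R) : invariant a b f -> invariant a b (dy f).
Proof.
intros H u v G x y; unfold dy, Derive; f_equal; apply Lim_ext; intros h.
replace (y + v + h) with (y + h + v) by ring; now rewrite !H.
Qed.

Lemma int2_lift_derivatives (a b : R) (f fx fy : R -> R -> R) : b <> 0 ->
  has_gradient f fx fy -> invariant a b f -> int2 (lift a b fx) = 0 /\ int2 (lift a b fy) = 0.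
Proof.
intros hb H P; assert (L := gradient_lift a b f fx fy H).
destruct (int2_derivatives _ _ _ L (lift_periodic a b f P)) as [E1 E2].
destruct H as (Cx & Cy & _).
split; auto; unfold lift in *.
rewrite int2_plus, !int2_scal, E1 in E2 by cont_tac.
apply (Rmult_eq_reg_l b); auto; lra.
Qed.

(** The divergences of grad u and of u grad u integrate to zero. *)
Lemma energy (a b mu : R) (q u : R -> R -> R) : b <> 0 -> Cinf a b u -> cont2 q ->
  (forall x y, dx (dx u) x y + dy (dy u) x y = - (mu * (q x y * u x y))) ->
  mu * int2 (lift a b (fun x y => q x y * u x y)) = 0 /\
  int2 (lift a b (fun x y => dx u x y ^ 2 + dy u x y ^ 2)) =
  mu * int2 (lift a b (fun x y => q x y * u x y ^ 2)).
Proof.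
intros hb [S P] Cq E.
assert (H := Ck1_gradient u (S 1%nat)).
assert (Hx := Ck1_gradient (dx u) (proj1 (proj2 (S 2%nat)))).
assert (Hy := Ck1_gradient (dy u) (proj2 (proj2 (S 2%nat)))).
assert (Cu := gradient_cont _ _ _ H).
destruct (H) as (Cx & Cy & _); destruct (Hx) as (Cxx & Cxy & _); destruct (Hy) as (Cyx & Cyy & _).
assert (Px := invariant_dx a b u P); assert (Py := invariant_dy a b u P).
split.
- rewrite <- int2_scal by (unfold lift; cont_tac).
  rewrite (int2_ext _ (fun s t => -1 * (lift a b (dx (dx u)) s t + lift a b (dy (dy u)) s t)))
    by (intros; unfold lift; rewrite E; ring).
  rewrite int2_scal, int2_plus by (unfold lift; cont_tac).
  rewrite (proj1 (int2_lift_derivatives a b _ _ _ hb Hx Px)),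
    (proj2 (int2_lift_derivatives a b _ _ _ hb Hy Py)); ring.
- rewrite <- int2_scal by (unfold lift; cont_tac).
  assert (I1 := int2_lift_derivatives a b _ _ _ hb (gradient_mult _ _ _ _ _ _ H Hx)
    ltac:(intros p v G x y; now rewrite P, Px)).
  assert (I2 := int2_lift_derivatives a b _ _ _ hb (gradient_mult _ _ _ _ _ _ H Hy)
    ltac:(intros p v G x y; now rewrite P, Py)).
  rewrite (int2_ext (lift a b (fun x y => dx u x y ^ 2 + dy u x y ^ 2)) (fun s t =>
    lift a b (fun x y => dx u x y * dx u x y + u x y * dx (dx u) x y) s t
    + lift a b (fun x y => dy u x y * dy u x y + u x y * dy (dy u) x y) s t
    + mu * lift a b (fun x y => q x y * u x y ^ 2) s t)).
  + rewrite !int2_plus, (proj1 I1), (proj2 I2) by (unfold lift; cont_tac); ring.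
  + intros s t; unfold lift.
    specialize (E (s + t * a) (t * b)).
    replace (mu * (q (s + t * a) (t * b) * u (s + t * a) (t * b) ^ 2))
      with (- (- (mu * (q (s + t * a) (t * b) * u (s + t * a) (t * b))) * u (s + t * a) (t * b))) by ring.
    rewrite <- E; ring.
Qed.

Lemma periodic_Z (f : R -> R) : periodic f -> forall (n : Z) x, f (x + IZR n) = f x.
Proof.
intros P n; induction n as [|n IH|n IH] using Z.peano_ind; intros x.
- now rewrite Rplus_0_r.
- unfold Z.succ; rewrite plus_IZR, <- Rplus_assoc, P; apply IH.
- unfold Z.pred; rewrite plus_IZR, <- P.
  rewrite <- (IH x); f_equal; simpl; ring.
Qed.

Lemma invariant_y (a b : R) (f : R -> R) : b <> 0 -> periodic f ->
  invariant a b (fun _ y => f (y / b)).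
Proof.
intros hb P u v (m & n & _ & ->) x y.
rewrite <- (periodic_Z f P n (y / b)); f_equal; field; auto.
Qed.

(** * Smoothness of the explicit functions *)

(** A class of functions of one variable that contains the conformal factor,
    its logarithm and the eigenfunction, and is closed under differentiation:
    this closure alone makes all its members smooth. *)
Inductive elem : (R -> R) -> Prop :=
| elem_const c : elem (fun _ => c)
| elem_id : elem (fun x => x)
| elem_plus f g : elem f -> elem g -> elem (fun x => f x + g x)
| elem_opp f : elem f -> elem (fun x => - f x)
| elem_mult f g : elem f -> elem g -> elem (fun x => f x * g x)
| elem_inv f : (forall x, f x <> 0) -> elem f -> elem (fun x => / f x)
| elem_sin f : elem f -> elem (fun x => sin (f x))
| elem_cos f : elem f -> elem (fun x => cos (f x))
| elem_exp f : elem f -> elem (fun x => exp (f x))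
| elem_ln f : (forall x, 0 < f x) -> elem f -> elem (fun x => ln (f x)).

Lemma elem_derive (f : R -> R) : elem f ->
  exists f', elem f' /\ forall x, is_derive f x (f' x).
Proof.
intros H; induction H as
  [c| |f g _ [f' [Ef Df]] _ [g' [Eg Dg]]|f _ [f' [Ef Df]]
  |f g Hf [f' [Ef Df]] Hg [g' [Eg Dg]]|f Hn Hf [f' [Ef Df]]
  |f Hf [f' [Ef Df]]|f Hf [f' [Ef Df]]|f Hf [f' [Ef Df]]|f Hn Hf [f' [Ef Df]]].
- exists (fun _ => 0); split; [apply elem_const|intros; auto_derive; auto].
- exists (fun _ => 1); split; [apply elem_const|intros; auto_derive; auto].
- exists (fun x => f' x + g' x); split; [now apply elem_plus|intros; now apply (is_derive_plus f g)].
- exists (fun x => - f' x); split; [now apply elem_opp|intros; now apply (is_derive_opp f)].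
- exists (fun x => f' x * g x + f x * g' x); split.
  + now apply elem_plus; apply elem_mult.
  + intros; apply (is_derive_mult f g); auto; intros; apply Rmult_comm.
- exists (fun x => - (f' x * (/ f x * / f x))); split.
  + now apply elem_opp, elem_mult; [|apply elem_mult; apply elem_inv].
  + intros x; evar_last; [now apply (is_derive_inv f x (f' x))|simpl; field; auto].
- exists (fun x => f' x * cos (f x)); split.
  + now apply elem_mult; [|apply elem_cos].
  + intros x; apply (is_derive_comp sin f); auto; apply is_derive_Reals, derivable_pt_lim_sin.
- exists (fun x => f' x * - sin (f x)); split.
  + now apply elem_mult; [|apply elem_opp, elem_sin].
  + intros x; apply (is_derive_comp cos f); auto; apply is_derive_Reals, derivable_pt_lim_cos.
- exists (fun x => f' x * exp (f x)); split.
  + now apply elem_mult; [|apply elem_exp].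
  + intros x; apply (is_derive_comp exp f); auto; apply is_derive_Reals, derivable_pt_lim_exp.
- exists (fun x => f' x * / f x); split.
  + apply elem_mult; auto; apply elem_inv; auto; intros x; specialize (Hn x); lra.
  + intros x; apply (is_derive_comp ln f); auto; apply is_derive_Reals, derivable_pt_lim_ln; auto.
Qed.

Lemma dx_y (f : R -> R) : dx (fun _ y => f y) = (fun _ _ => 0).
Proof.
apply functional_extensionality; intros x; apply functional_extensionality; intros y.
apply (Derive_const (f y)).
Qed.

Lemma dy_y (f f' : R -> R) : (forall x, is_derive f x (f' x)) ->
  dy (fun _ y => f y) = (fun _ y => f' y).
Proof.
intros D.
apply functional_extensionality; intros x; apply functional_extensionality; intros y.
apply is_derive_unique, D.
Qed.

Lemma smooth_y (f : R -> R) : elem f -> smooth (fun _ y => f y).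
Proof.
intros H n; revert f H; induction n as [|n IH]; intros f H;
  destruct (elem_derive f H) as (f' & H' & D).
- assert (C := cont_derive f f' D).
  simpl; apply (proj1 (cont2_pt (fun _ y : R => f y))).
  exact (cont_comp f (fun p : R * R => snd p) C cont_snd).
- split; [|split].
  + intros x y; split; [apply (ex_derive_const (f y))|exists (f' y); apply D].
  + rewrite dx_y; apply Ck_const.
  + rewrite (dy_y f f' D); now apply IH.
Qed.

Lemma elem_speed (e b : R) : elem (fun y => speed e (y / b)).
Proof.
unfold speed, Rdiv.
repeat first [apply elem_plus | apply elem_mult | apply elem_cos | apply elem_const | apply elem_id].
Qed.

Lemma elem_phase (e b : R) : elem (fun y => phase e (y / b)).
Proof.
unfold phase, Rdiv.
repeat first [apply elem_plus | apply elem_mult | apply elem_sin | apply elem_const | apply elem_id].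
Qed.

Lemma elem_weight (e b : R) : 0 <= e <= 1 / 10 -> elem (fun y => weight e (y / b)).
Proof.
intros He; assert (G := elem_speed e b).
assert (N : forall y, speed e (y / b) <> 0) by (intros y; generalize (speed_bounds e (y / b) He); lra).
assert (I := elem_inv _ N G).
assert (S : elem (fun y => sin (2 * PI * (y / b))))
  by (apply elem_sin, elem_mult, elem_mult; [apply elem_const|apply elem_id|apply elem_const]).
assert (C : elem (fun y => cos (2 * PI * (y / b))))
  by (apply elem_cos, elem_mult, elem_mult; [apply elem_const|apply elem_id|apply elem_const]).
assert (K := elem_const).
assert (E : (fun y => weight e (y / b)) = (fun y =>
  (speed e (y / b) * speed e (y / b) + - (e / 2 * (cos (2 * PI * (y / b)) * / speed e (y / b))))
  + - (3 / 4 * ((e * (sin (2 * PI * (y / b)) * / speed e (y / b)))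
               * (e * (sin (2 * PI * (y / b)) * / speed e (y / b))))))).
{ apply functional_extensionality; intros y; unfold weight; specialize (N y); field; auto. }
rewrite E.
repeat first [assumption | apply elem_plus | apply elem_opp | apply elem_mult | apply K ].
Qed.

(** * The metrics with weight depending on y, and their first eigenvalue *)

(** The flat metric is the case e = 0. *)
Definition has_weight (a b e : R) (g : metric a b) : Prop :=
  forall x y, gE g x y = weight e (y / b) /\ gF g x y = 0 /\ gG g x y = weight e (y / b).

Lemma has_weight_dens (a b e : R) (g : metric a b) : 0 <= e <= 1 / 10 -> has_weight a b e g ->
  forall x y, dens g x y = weight e (y / b).
Proof.
intros He S x y; unfold dens; destruct (S x y) as (-> & -> & ->).
replace (weight e (y / b) * weight e (y / b) - 0 ^ 2) with (Rsqr (weight e (y / b))) by (unfold Rsqr; ring).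
apply sqrt_Rsqr; generalize (weight_pos e (y / b) He); lra.
Qed.

Lemma has_weight_laplace (a b e : R) (g : metric a b) (u : R -> R -> R) (x y : R) :
  0 <= e <= 1 / 10 -> has_weight a b e g ->
  laplace g u x y = - (/ weight e (y / b) * (dx (dx u) x y + dy (dy u) x y)).
Proof.
intros He S; unfold laplace; rewrite (has_weight_dens a b e g He S).
replace (fun x y => (gG g x y * dx u x y - gF g x y * dy u x y) / dens g x y) with (dx u).
2:{ apply functional_extensionality; intros x'; apply functional_extensionality; intros y'.
  rewrite (has_weight_dens a b e g He S); destruct (S x' y') as (_ & -> & ->).
  field; generalize (weight_pos e (y' / b) He); lra. }
replace (fun x y => (gE g x y * dy u x y - gF g x y * dx u x y) / dens g x y) with (dy u).
2:{ apply functional_extensionality; intros x'; apply functional_extensionality; intros y'.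
  rewrite (has_weight_dens a b e g He S); destruct (S x' y') as (-> & -> & _).
  field; generalize (weight_pos e (y' / b) He); lra. }
reflexivity.
Qed.

Lemma has_weight_area (a b e : R) (g : metric a b) : 0 <= e <= 1 / 10 -> 0 < b -> has_weight a b e g ->
  area g = b * RInt (weight e) 0 1.
Proof.
intros He hb S; unfold area.
assert (Cw := cont_weight e He).
transitivity (int2 (fun _ t => b * weight e t)); [|now rewrite int2_t, int_scal].
apply (int2_ext (fun s t => dens g (s + t * a) (t * b) * Rabs b)); intros s t.
rewrite (has_weight_dens a b e g He S), Rabs_pos_eq by lra.
replace (t * b / b) with t by (field; lra); ring.
Qed.

Lemma int_weight_0 : RInt (weight 0) 0 1 = 1.
Proof.
rewrite (int_ext _ (fun _ => 1)) by apply weight_0; rewrite int_const; real_eq; ring.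
Qed.

(** Up to the derivative of a periodic function, the weight equals 1 + e^2 / 2
    - (e sin / speed)^2 / 4, and the last term is at most (100 / 324) e^2
    because the speed is at least 9 / 10. *)
Lemma int_weight_gt_1 (e : R) : 0 < e <= 1 / 10 -> 1 < RInt (weight e) 0 1.
Proof.
intros He.
assert (He' : 0 <= e <= 1 / 10) by lra.
assert (Cw := cont_weight e He').
set (s t := sin (2 * PI * t)); set (c t := cos (2 * PI * t)).
(* P is periodic, and up to the factor 4 PI^2 its derivative P' consists of half
   of the derivative of phi'' / phi' and of the oscillating part of phi'^2. *)
set (P t := (2 * e * s t - e * s t / (2 * speed e t) + e ^ 2 * s t * c t / 2) / (2 * PI)).
set (P' t := 2 * e * c t - e * c t / (2 * speed e t) - (e * s t / speed e t) ^ 2 / 2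
   + e ^ 2 * (c t ^ 2 - s t ^ 2) / 2).
assert (N : forall t, 0 < speed e t) by (intros t; generalize (speed_bounds e t He'); lra).
assert (dP : forall t, is_derive P t (P' t)).
{ intros t; specialize (N t); unfold P, P', s, c, speed in *; auto_derive.
  - repeat split; auto; lra.
  - field; generalize PI_neq0; intuition lra. }
assert (CP' : cont P').
{ intros t; apply (ex_derive_continuous (V := R_NormedModule) P').
  specialize (N t); unfold P', s, c, speed in *; auto_derive; repeat split; auto; lra. }
assert (I : RInt P' 0 1 = 0).
{ rewrite (int_derive P P') by auto; unfold P, s, c, speed; rewrite <- (Rplus_0_l 1).
  destruct (sin_cos_period 0) as [-> ->]; real_eq; ring. }
apply Rlt_le_trans with (1 + e ^ 2 / 10); [nra|].
replace (RInt (weight e) 0 1) with (RInt (fun t => weight e t - P' t) 0 1)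
  by (rewrite int_minus, I by auto; real_eq; ring).
replace (1 + e ^ 2 / 10) with (RInt (fun _ => 1 + e ^ 2 / 10) 0 1)
  by (rewrite int_const; real_eq; ring).
apply int_le; [lra|apply cont_const|cont_tac|]; intros t.
assert (D : weight e t - P' t = 1 + e ^ 2 * (c t ^ 2 + s t ^ 2) / 2 - (e * s t / speed e t) ^ 2 / 4).
{ specialize (N t); unfold weight, P', s, c, speed in *; field; lra. }
assert (SC : c t ^ 2 + s t ^ 2 = 1).
{ generalize (sin2_cos2 (2 * PI * t)); unfold Rsqr, s, c; lra. }
rewrite D, SC.
assert (B := speed_bounds e t He').
assert (I1 : 0 < / speed e t <= 10 / 9).
{ split; [apply Rinv_0_lt_compat; lra|].
  replace (10 / 9) with (/ (9 / 10)) by field; apply Rinv_le_contravar; lra. }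
replace ((e * s t / speed e t) ^ 2) with (e ^ 2 * (s t ^ 2 * (/ speed e t) ^ 2))
  by (field; specialize (N t); lra).
set (i := / speed e t) in *.
assert (0 <= i ^ 2 <= 100 / 81) by nra.
assert (0 <= s t ^ 2 <= 1) by (generalize (pow2_ge_0 (c t)) (pow2_ge_0 (s t)); lra).
assert (0 <= s t ^ 2 * i ^ 2 <= 100 / 81) by nra.
assert (0 <= e ^ 2) by apply pow2_ge_0.
assert (e ^ 2 * (s t ^ 2 * i ^ 2) <= e ^ 2 * (100 / 81)) by (apply Rmult_le_compat_l; lra).
lra.
Qed.

(** For mu = 0 the energy vanishes.  Otherwise u has weighted mean zero, and
    [weighted_poincare] with the coefficients of the Euclidean metric on the
    lattice geodesics shows that the energy mu N, for the weighted norm N of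
    u, is at least 4 PI^2 / b^2 N; so N = 0. *)
Lemma low_eigenfunction_constant (a b e mu : R) (g : metric a b) (u : R -> R -> R) :
  0 <= e <= 1 / 10 -> 0 < b -> 0 <= a <= 1 / 2 -> 1 + 3 * e <= a ^ 2 + b ^ 2 ->
  has_weight a b e g -> eigenspace g mu u -> mu < 4 * PI ^ 2 / b ^ 2 ->
  forall x y, u x y = u 0 0.
Proof.
intros He hb ha hab Sg [Hu Eu] Hmu.
assert (hb0 : b <> 0) by lra.
assert (hb2 : 0 < b ^ 2) by nra.
assert (Cw := cont_weight e He).
set (q := fun _ y : R => weight e (y / b)).
assert (Cq : cont2 q).
{ unfold q, Rdiv; cont_tac. }
assert (E : forall x y, dx (dx u) x y + dy (dy u) x y = - (mu * (q x y * u x y))).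
{ intros x y; specialize (Eu x y); rewrite (has_weight_laplace a b e g u x y He Sg) in Eu.
  unfold q; assert (W := proj1 (weight_pos e (y / b) He)); set (w := weight e (y / b)) in *.
  rewrite <- Rmult_assoc, (Rmult_comm mu), Rmult_assoc, <- Eu; field; lra. }
destruct (energy a b mu q u hb0 Hu Cq E) as [E1 E2].
destruct Hu as [S P].
assert (H := Ck1_gradient u (S 1%nat)).
assert (Cu := gradient_cont _ _ _ H); destruct (H) as (Cx & Cy & _).
assert (PU := lift_periodic a b u P).
assert (qt : forall s t, lift a b q s t = weight e t).
{ intros s t; unfold lift, q; f_equal; field; auto. }
assert (grad0 : (forall x y, dx u x y = 0) -> (forall x y, dy u x y = 0) ->
  forall x y, u x y = u 0 0).
{ intros X Y x y; transitivity (u 0 y).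
  - apply (zero_derive_const (fun z => u z y)); intros z.
    evar_last; [apply (gradient_s _ _ _ H)|apply X].
  - apply (zero_derive_const (fun z => u 0 z)); intros z.
    evar_last; [apply (gradient_t _ _ _ H)|apply Y]. }
destruct (Req_dec mu 0) as [->|Hmu0].
- rewrite Rmult_0_l in E2.
  assert (Z : forall x y, dx u x y ^ 2 + dy u x y ^ 2 = 0).
  { intros x y; rewrite (lift_surj a b (fun x y => dx u x y ^ 2 + dy u x y ^ 2) x y hb0).
    apply int2_zero; auto.
    - unfold lift; cont_tac.
    - apply lift_periodic; intros v w G x' y'; now rewrite (invariant_dx a b u P), (invariant_dy a b u P).
    - intros s t; unfold lift; nra. }
  apply grad0; intros x y; specialize (Z x y); nra.
- assert (E3 : int2 (fun s t => weight e t * lift a b u s t) = 0).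
  { apply (Rmult_eq_reg_l mu); auto; rewrite Rmult_0_r, <- E1; f_equal; apply int2_ext; intros s t.
    now rewrite <- (qt s t). }
  assert (E4 : int2 (lift a b (fun x y => q x y * u x y ^ 2)) = int2 (fun s t => weight e t * lift a b u s t ^ 2)).
  { apply int2_ext; intros s t; now rewrite <- (qt s t). }
  assert (IB : 0 < / b ^ 2) by (apply Rinv_0_lt_compat; lra).
  assert (HA : 0 <= (a ^ 2 + b ^ 2 - a) / b ^ 2) by (apply Rmult_le_pos; lra).
  assert (HBC : 0 <= a / b ^ 2 <= (1 - a) / b ^ 2).
  { split; [apply Rmult_le_pos|apply Rmult_le_compat_r]; lra. }
  assert (HABC : (1 + 3 * e) * ((1 - a) / b ^ 2 + a / b ^ 2)
     <= (a ^ 2 + b ^ 2 - a) / b ^ 2 + a / b ^ 2).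
  { replace ((1 + 3 * e) * ((1 - a) / b ^ 2 + a / b ^ 2)) with ((1 + 3 * e) / b ^ 2) by (field; auto).
    replace ((a ^ 2 + b ^ 2 - a) / b ^ 2 + a / b ^ 2) with ((a ^ 2 + b ^ 2) / b ^ 2) by (field; auto).
    apply Rmult_le_compat_r; lra. }
  assert (W := weighted_poincare e ((a ^ 2 + b ^ 2 - a) / b ^ 2) ((1 - a) / b ^ 2) (a / b ^ 2)
    _ _ _ He HA HBC HABC (gradient_lift a b _ _ _ H) PU E3).
  match type of W with _ <= ?r =>
    assert (G : r = int2 (lift a b (fun x y => dx u x y ^ 2 + dy u x y ^ 2)))
      by (apply int2_ext; intros; unfold lift; field; auto) end.
  apply Rle_trans with (2 := Req_le _ _ G) in W; clear G; rewrite E2, E4 in W.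
  set (N := int2 (fun s t => weight e t * lift a b u s t ^ 2)) in *.
  assert (CN : cont2 (fun s t => weight e t * lift a b u s t ^ 2)) by (unfold lift; cont_tac).
  assert (N0 : forall s t, 0 <= weight e t * lift a b u s t ^ 2).
  { intros s t; apply Rmult_le_pos; [generalize (weight_pos e t He); lra|apply pow2_ge_0]. }
  assert (NN := int2_ge_0 _ CN N0); fold N in NN.
  replace (4 * PI ^ 2 * ((1 - a) / b ^ 2 + a / b ^ 2)) with (4 * PI ^ 2 / b ^ 2) in W by (field; auto).
  assert (Z : N = 0) by nra.
  assert (U0 : forall x y, u x y = 0).
  { intros x y; rewrite (lift_surj a b u x y hb0).
    assert (T := int2_zero _ CN
      ltac:(split; intros; rewrite ?weight_period; do 2 f_equal; apply PU) N0 Z (x - y / b * a) (y / b)).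
    destruct (Rmult_integral _ _ T) as [Z1|Z1]; [generalize (weight_pos e (y / b) He); lra|].
    apply Rsqr_0_uniq; unfold Rsqr; lra. }
  intros x y; now rewrite !U0.
Qed.

(** This is cos(phi) / sqrt(phi'), up to a constant factor; the square root is
    written through exp and ln, which stay in the class [elem]. *)
Definition eigenfun (e t : R) : R := cos (phase e t) * exp (- / 2 * ln (speed e t)).

Lemma elem_eigenfun (e b : R) : 0 <= e <= 1 / 10 -> elem (fun y => eigenfun e (y / b)).
Proof.
intros He.
apply elem_mult; [apply elem_cos, elem_phase|].
apply elem_exp, elem_mult; [apply elem_const|apply elem_ln, elem_speed].
intros y; generalize (speed_bounds e (y / b) He); lra.
Qed.

Lemma eigenfun_derive2 (e b : R) : 0 <= e <= 1 / 10 -> 0 < b ->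
  exists f', (forall y, is_derive (fun y => eigenfun e (y / b)) y (f' y)) /\
  forall y, is_derive f' y (- (4 * PI ^ 2 / b ^ 2 * (weight e (y / b) * eigenfun e (y / b)))).
Proof.
intros He hb.
set (r y := exp (- / 2 * ln (speed e (y / b)))).
set (s y := sin (2 * PI * (y / b))).
set (k := 2 * PI / b).
assert (N : forall y, 0 < speed e y) by (intros y; generalize (speed_bounds e y He); lra).
exists (fun y => k * (e * s y / (2 * speed e (y / b)) * r y * cos (phase e (y / b))
   - speed e (y / b) * r y * sin (phase e (y / b)))).
split; intros y; specialize (N (y / b)); unfold eigenfun, r, s, k, weight, speed, phase, Rdiv in *;
  auto_derive; repeat split; auto; try lra.
- field; lra.
- field; lra.
Qed.

Lemma eigenfun_eigenspace (a b e : R) (g : metric a b) : 0 <= e <= 1 / 10 -> 0 < b ->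
  has_weight a b e g -> eigenspace g (4 * PI ^ 2 / b ^ 2) (fun _ y => eigenfun e (y / b)).
Proof.
intros He hb Sg; split; [split|].
- exact (smooth_y _ (elem_eigenfun e b He)).
- apply (invariant_y a b (eigenfun e)); [lra|intros t; unfold eigenfun].
  rewrite phase_period; unfold speed; destruct (sin_cos_period t) as [_ ->].
  f_equal; rewrite <- (cos_period (phase e t) 1); f_equal; simpl; ring.
- intros x y; rewrite (has_weight_laplace a b e) by auto.
  destruct (eigenfun_derive2 e b He hb) as (f' & D1 & D2).
  rewrite dx_y, (dy_y (fun y => eigenfun e (y / b)) f' D1), (dy_y f' _ D2), (dx_y (fun _ => 0)).
  assert (W := weight_pos e (y / b) He); field; split; lra.
Qed.

(** The two halves of [is_lambda] at different levels contradict each other,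
    so the value chosen by [epsilon] is the only one. *)
Lemma lambda_unique (a b : R) (k : nat) (g : metric a b) (l : R) :
  is_lambda k g l -> lambda k g = l.
Proof.
intros H.
assert (H' := epsilon_spec (inhabits 0) (is_lambda k g) (ex_intro _ l H)).
fold (lambda k g) in H'.
destruct H as [H1 H2], H' as [H1' H2'].
assert (mono : forall P Q : R -> Prop, (forall m, P m -> Q m) ->
  more_eigenvalues g P k -> more_eigenvalues g Q k).
{ intros P Q PQ (u & L & E); exists u; split; auto.
  intros i Hi; destruct (E i Hi) as (m & Pm & Em); eauto. }
destruct (Rtotal_order (lambda k g) l) as [L|[L|L]]; auto; exfalso.
- apply H1, (mono (fun m => m <= lambda k g)); auto; intros; lra.
- apply H1', (mono (fun m => m <= l)); auto; intros; lra.
Qed.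

(** Below 4 PI^2 / b^2 there are only constants, and these do not give two
    independent eigenfunctions; the constant 1 and [eigenfun] show that the
    level is reached. *)
Lemma has_weight_lambda (a b e : R) (g : metric a b) :
  0 <= e <= 1 / 10 -> 0 < b -> 0 <= a <= 1 / 2 -> 1 + 3 * e <= a ^ 2 + b ^ 2 ->
  has_weight a b e g -> lambda 1 g = 4 * PI ^ 2 / b ^ 2.
Proof.
intros He hb ha hab Sg; apply lambda_unique; split.
- intros (u & L & E).
  destruct (E 0%nat ltac:(auto)) as (m0 & M0 & E0).
  destruct (E 1%nat ltac:(auto)) as (m1 & M1 & E1).
  assert (C0 := low_eigenfunction_constant a b e m0 g (u 0%nat) He hb ha hab Sg E0 M0).
  assert (C1 := low_eigenfunction_constant a b e m1 g (u 1%nat) He hb ha hab Sg E1 M1).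
  set (c0 := u 0%nat 0 0) in *; set (c1 := u 1%nat 0 0) in *.
  destruct (Req_dec c1 0) as [Z|Z].
  (* Coefficients of a vanishing combination: (0, 1) if the second function is
     zero, and (c1, - c0) otherwise. *)
  + assert (A := L (fun i => INR i)).
    assert (B : INR 1 = 0); [|simpl in B; lra].
    apply A; auto; intros x y; simpl; rewrite C1, Z; ring.
  + assert (A := L (fun i => match i with O => c1 | _ => - c0 end)).
    apply Z, (A ltac:(intros x y; simpl; rewrite C0, C1; ring) 0%nat); auto.
- exists (fun i => match i with O => fun _ _ => 1 | _ => fun _ y => eigenfun e (y / b) end); split.
  + intros c Hc.
    (* At t = 0 and t = 1/2 the phase is 0 and PI, where the cosine has opposite
       signs. *)
    assert (Y0 := Hc 0 0); assert (Y1 := Hc 0 (/ 2 * b)); simpl in Y0, Y1.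
    assert (P0 := exp_pos (- / 2 * ln (speed e 0))).
    assert (P1 := exp_pos (- / 2 * ln (speed e (/ 2)))).
    unfold eigenfun in Y0, Y1.
    replace (0 / b) with 0 in Y0 by (field; lra).
    replace (/ 2 * b / b) with (/ 2) in Y1 by (field; lra).
    replace (phase e 0) with 0 in Y0 by (unfold phase; rewrite Rmult_0_r, sin_0; ring).
    replace (phase e (/ 2)) with PI in Y1
      by (unfold phase; replace (2 * PI * / 2) with PI by field; rewrite sin_PI; ring).
    rewrite cos_0 in Y0; rewrite cos_PI in Y1.
    set (p := exp _) in Y0, P0; set (q := exp _) in Y1, P1.
    assert (Z1 : c 1%nat = 0).
    { apply (Rmult_eq_reg_r (p + q)); lra. }
    rewrite Z1 in Y0.
    intros [|[|i]] Hi; [lra|auto|lia].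
  + assert (0 < PI ^ 2) by (apply pow_lt, PI_RGT_0).
    assert (0 < b ^ 2) by (apply pow_lt; lra).
    intros [|i] _.
    * exists 0; split; [apply Rlt_le, Rdiv_lt_0_compat; lra|].
      split; [apply Cinf_const|intros x y; rewrite (has_weight_laplace a b e) by auto].
      assert (D0 : forall c : R, dy (fun _ _ : R => c) = (fun _ _ => 0))
        by (intros c'; apply (dy_y (fun _ => c') (fun _ => 0)); intros; apply (is_derive_const c')).
      rewrite (dx_y (fun _ => 1)), D0, D0, (dx_y (fun _ => 0)); ring.
    * exists (4 * PI ^ 2 / b ^ 2); split; [lra|].
      exact (eigenfun_eigenspace a b e g He hb Sg).
Qed.

(** * The comparison of the two metrics *)

Theorem theorem1p1 (a b : R) (hb : 0 < b) (hab : a ^ 2 + b ^ 2 > 1)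
    (ha : 0 <= a <= 1 / 2) :
  ~ conformally_maximal 1%nat (flat_metric a b) /\
  exists h : metric a b,
    conformal (flat_metric a b) h /\
    lambda 1%nat h * area h >
      lambda 1%nat (flat_metric a b) * area (flat_metric a b).
Proof.
assert (X : exists h : metric a b, conformal (flat_metric a b) h /\
    lambda 1%nat h * area h >
      lambda 1%nat (flat_metric a b) * area (flat_metric a b)).
(* The bound 1 + 3 e of the weight must not exceed a^2 + b^2. *)
{ set (e := Rmin (1 / 10) ((a ^ 2 + b ^ 2 - 1) / 3)).
  assert (e1 : e <= 1 / 10) by apply Rmin_l.
  assert (e2 : e <= (a ^ 2 + b ^ 2 - 1) / 3) by apply Rmin_r.
  assert (e0 : 0 < e) by (apply Rmin_glb_lt; lra).
  assert (He : 0 <= e <= 1 / 10) by lra.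
  assert (Cw : Cinf a b (fun _ y => weight e (y / b))).
  { split; [now apply smooth_y, elem_weight|apply invariant_y; [lra|apply weight_period]]. }
  assert (pos : forall x y : R, 0 < weight e (y / b) /\
    0 < weight e (y / b) * weight e (y / b) - 0 ^ 2).
  { intros _ y; generalize (weight_pos e (y / b) He); nra. }
  set (h := Metric Cw (Cinf_const a b 0) Cw pos).
  assert (Sh : has_weight a b e h) by (intros x y; repeat split).
  assert (Sf : has_weight a b 0 (flat_metric a b)) by (intros x y; rewrite weight_0; repeat split).
  exists h; split.
  - exists (fun _ y => / 2 * ln (weight e (y / b))); split.
    + split.
      * apply (smooth_y (fun y => / 2 * ln (weight e (y / b)))).
        apply elem_mult; [apply elem_const|apply elem_ln, elem_weight; auto].
        intros y; generalize (weight_pos e (y / b) He); lra.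
      * apply (invariant_y a b (fun t => / 2 * ln (weight e t))); [lra|].
        intros t; now rewrite weight_period.
    + intros x y; simpl.
      replace (2 * (/ 2 * ln (weight e (y / b)))) with (ln (weight e (y / b))) by field.
      rewrite exp_ln by (generalize (weight_pos e (y / b) He); lra); repeat split; ring.
  - rewrite (has_weight_lambda a b e h He hb ha), (has_weight_lambda a b 0 (flat_metric a b)) by (auto; lra).
    rewrite (has_weight_area a b e h), (has_weight_area a b 0 (flat_metric a b)), int_weight_0 by (auto; lra).
    assert (I := int_weight_gt_1 e ltac:(lra)).
    assert (0 < PI ^ 2) by (apply pow_lt, PI_RGT_0).
    apply Rmult_lt_compat_l; [apply Rdiv_lt_0_compat; [lra|apply pow_lt; lra]|].
    apply Rmult_lt_compat_l; auto. }
split; auto; destruct X as (h & Ch & Hh); unfold conformally_maximal, Lambda, lambda_bar; intros E.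
match type of E with _ = Lub_Rbar ?S => destruct (Lub_Rbar_correct S) as [U _] end.
rewrite <- E in U; specialize (U (lambda 1 h * area h) (ex_intro _ h (conj Ch eq_refl))).
simpl in U; lra.
Qed.
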